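(* Let $p$ be a prime, let $n,R\geq1$ and $d$ be integers with $2\leq d<p$, and let $P=(P_1,\ldots,P_R):\mathbb{F}_p^n\to\mathbb{F}_p^R$ be a polynomial map whose components $P_i$ are homogeneous polynomials of degree $d$ over $\mathbb{F}_p$. Let $v\in\mathbb{F}_p^R$, $S=P^{-1}(v)\subseteq\mathbb{F}_p^n$, and $K=\operatorname{codim}(S_P^* )$. Then $$\|\mathbf{1}_S-p^{-R}\|_{U^d}\leq (d-1)^{2^{-d}n}\,p^{2^{-d}(R-K)}.$$
   Context: $\mathbf{1}_S$ is the indicator function of $S$, and $p^{-R}$ denotes the constant function. Gowers norms: for $f:\mathbb{F}_p^n\to\mathbb{C}$ put $\Delta_hf(x)=f(x+h)\overline{f(x)}$ and $\Delta_{h_1,\ldots,h_l}f=\Delta_{h_l}(\Delta_{h_1,\ldots,h_{l-1}}f)$. Then $\|f\|_{U^l}\geq0$ is defined by $\|f\|_{U^l}^{2^l}=\mathbb{E}(\Delta_{h_1,\ldots,h_l}f(x):\ x,h_1,\ldots,h_l\in\mathbb{F}_p^n)$, where $\mathbb{E}$ denotes the average over the indicated variables. Singular set: $S_P^*=\{x:\operatorname{rank}(Jac_P(x))<R\}$, where $Jac_P(x)$ is the $R\times n$ matrix with entries $\partial_{x_j}P_i(x)$. It is regarded as an algebraic subset of $\bar{\mathbb{F}}_p^n$ ($\bar{\mathbb{F}}_p$ the algebraic closure of $\mathbb{F}_p$), and $\operatorname{codim}(S_P^* )=n-\dim S_P^*$ is computed over $\bar{\mathbb{F}}_p$. *)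

(* Defs.v *)
From HB Require Import structures.
From mathcomp Require Import all_boot all_order all_algebra.
From mathcomp Require Import mxpoly complex.
From mathcomp Require Import mpoly.
From mathcomp Require Import boolp classical_sets reals exp.

Set Implicit Arguments.
Unset Strict Implicit.
Unset Printing Implicit Defensive.

Import Order.TTheory GRing.Theory Num.Theory.

Local Open Scope ring_scope.

Section Gowers.

Variables (R : realType) (G : finZmodType).

Definition average (T : finType) (F : T -> R[i]) : R[i] :=
  (\sum_(t : T) F t) / #|T|%:R.

Definition mul_deriv (h : G) (f : G -> R[i]) : G -> R[i] :=
  fun x => f (x + h) * (f x)^*.

(* The head of [hs] is differentiated first. *)
Definition mul_derivs (hs : seq G) (f : G -> R[i]) : G -> R[i] :=
  foldl (fun g h => mul_deriv h g) f hs.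

(* For 0 < l the average is a nonnegative real number, so taking its real part
   only changes the type. *)
Definition gowers_norm (l : nat) (f : G -> R[i]) : R :=
  complex.Re (average (fun t : G * l.-tuple G => mul_derivs t.2 f t.1))
    `^ (2 ^+ l)^-1.

End Gowers.

Section Zariski.

Local Open Scope classical_set_scope.

Variables (F : fieldType) (n : nat).

Definition peval (f : {mpoly F[n]}) (x : 'rV[F]_n) : F := f.@[fun j => x 0 j].

Definition zero_locus (I : set {mpoly F[n]}) : set 'rV[F]_n :=
  [set x | forall f, I f -> peval f x = 0].

Definition zariski_closed (X : set 'rV[F]_n) : Prop :=
  exists I : set {mpoly F[n]}, X = zero_locus I.

Definition irreducible_closed (X : set 'rV[F]_n) : Prop :=
  [/\ zariski_closed X, X !=set0 &
      forall A B, zariski_closed A -> zariski_closed B ->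
        X `<=` A `|` B -> X `<=` A \/ X `<=` B].

(* A strictly increasing chain Z 0, ..., Z k of irreducible closed sets
   contained in X; the values of Z beyond k are irrelevant. *)
Definition has_chain (X : set 'rV[F]_n) (k : nat) : Prop :=
  exists Z : nat -> set 'rV[F]_n,
    (forall i, (i <= k)%N -> irreducible_closed (Z i) /\ Z i `<=` X) /\
    (forall i, (i < k)%N -> Z i `<` Z i.+1).

(* Krull dimension of the Zariski closed set X. *)
Definition is_dim (X : set 'rV[F]_n) (D : nat) : Prop :=
  has_chain X D /\ forall k, has_chain X k -> (k <= D)%N.

(* K = n - D, written additively to avoid truncated subtraction. *)
Definition is_codim (X : set 'rV[F]_n) (K : nat) : Prop :=
  exists2 D, is_dim X D & (D + K)%N = n.

End Zariski.

Section PolyMap.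

Variables (F : fieldType) (n r : nat) (P : 'I_r -> {mpoly F[n]}).

Definition pmap_eval (x : 'rV[F]_n) : 'rV[F]_r := \row_i peval (P i) x.

Definition jacobian (x : 'rV[F]_n) : 'M[F]_(r, n) :=
  \matrix_(i < r, j < n) peval (mderiv j (P i)) x.

End PolyMap.

(* [iota] embeds the field of coefficients in the field L over which the
   singular points are taken. *)
Definition singular_set (F L : fieldType) (iota : {rmorphism F -> L})
    (n r : nat) (P : 'I_r -> {mpoly F[n]}) : set 'rV[L]_n :=
  [set x | (\rank (jacobian (fun i => map_mpoly iota (P i)) x) < r)%N]%classic.

(* Main.v *)
(* Writing the indicator as p^-r times the sum of the characters of a . (P - v)
   over all a, and using convexity of the 2^d-th power of the Gowers norm, it
   suffices to bound the norm of each nontrivial character.  For Q = a . P that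
   power is the proportion of (h_1, ..., h_(d-1)) for which the polarized gradient
   Q(h_1, ..., h_(d-1), -) vanishes.  These are the F_p-points of a cone V cut out
   by n forms of degree d - 1, which meets the diagonal in the critical locus of
   Q, a subset of the singular set; hence codim V >= K.  Choosing linear forms
   l_j that cut V down to {0} and adjoining the polynomials
   sum_i l_ij^p (x_i^p - x_i), whose leading forms are the l_j^p and which vanish
   on F_p^m, a Bezout count gives at most (d-1)^K p^(n(d-1)-K) points. *)

Require Import Defs.
From HB Require Import structures.
From mathcomp Require Import all_boot all_order all_algebra.
From mathcomp Require Import mxpoly complex.
From mathcomp Require Import mpoly.
From mathcomp Require Import boolp classical_sets reals exp.
From mathcomp Require Import zify ring.

Set Implicit Arguments.
Unset Strict Implicit.
Unset Printing Implicit Defensive.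

Import Order.TTheory GRing.Theory Num.Theory.

Local Open Scope ring_scope.

(** * Ideals and chain conditions *)

(** The obstacle in the point count is that V is cut out by n forms that need not be a complete
    intersection, so a product of degrees cannot simply be read off. The count is done by linear
    algebra instead. Put m = n(d-1) and c = m - K. In suitable coordinates, give weight p to the c
    variables matched with the adjoined polynomials and weight d-1 to the others: then every
    equation vanishes at every F_p-point of V to a weighted order at least its own degree. Modulo
    weighted order t along the points, all polynomials therefore reduce to degree below t plus a
    constant, and the number of points is at most the limiting ratio of monomials of degree < t to
    monomials of weight < t, which is the product of the weights, p^c (d-1)^(m-c). Dimension theory
    is used only in n-space, for the critical locus: the c linear forms on V are written down
    directly, as the n(d-2) coordinates of the differences between the h_i, which vanish on the
    diagonal, followed by n-K forms cutting the critical locus down to {0}. Restricting the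
    polarization to the diagonal costs a factor (d-1)!, invertible because d < p. *)

Definition ideal_pred (A : comNzRingType) (I : A -> Prop) : Prop :=
  [/\ I 0, forall x y, I x -> I y -> I (x + y) & forall a x, I x -> I (a * x)].

Section IdealPred.

Variables (A : comNzRingType) (I : A -> Prop) (idI : ideal_pred I).

Lemma ideal_sum (T : Type) (s : seq T) (Q : pred T) (F : T -> A) :
  (forall i, Q i -> I (F i)) -> I (\sum_(i <- s | Q i) F i).
Proof. by case: idI => I0 ID _ FI; apply: big_ind. Qed.

Lemma ideal_opp x : I x -> I (- x).
Proof. by case: idI => _ _ IM /(IM (-1)); rewrite mulN1r. Qed.

Lemma ideal_sub x y : I x -> I y -> I (x - y).
Proof. by case: (idI) => _ ID _ Ix Iy; apply: ID => //; apply: ideal_opp. Qed.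

End IdealPred.

(* Lying over: if no zero exists above [rho], some [f] in the ideal becomes 1;
   the matrix of multiplication by [f] on A['X]/(G) then becomes the identity,
   so its determinant is an element of the contraction outside the kernel. *)
Lemma ideal_root_above (A : comNzRingType) (k : closedFieldType)
    (rho : {rmorphism A -> k}) (sigma : {rmorphism k -> A})
    (J : {poly A} -> Prop) (G : {poly A}) :
  cancel sigma rho -> ideal_pred J -> J G -> G \is monic ->
  (forall a, J a%:P -> rho a = 0) ->
  exists b, forall q, J q -> (map_poly rho q).[b] = 0.
Proof.
move=> sK idJ JG Gm Jc; have [J0 JD JM] := idJ.
have mK p : map_poly rho (map_poly sigma p) = p.
  by rewrite -map_poly_comp map_poly_id // => x _ /=; rewrite sK.
apply: contrapT => nob.
have Gm' : map_poly rho G \is monic by rewrite monic_map.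
(* Among elements of [J] with nonzero image take one of least size. By division over [k] its image
   divides all the others, so a root of it would be the missing [b]; hence the image is a nonzero
   constant, and is scaled to 1. *)
have [f Jf f1] : exists2 f, J f & map_poly rho f = 1.
  pose P s := `[< exists f, [/\ J f, map_poly rho f != 0 &
                    size (map_poly rho f) = s] >].
  have exP : exists s, P s.
    exists (size (map_poly rho G)); apply/asboolP; exists G; split=> //.
    exact: monic_neq0.
  case: (ex_minnP exP) => s /asboolP[f [Jf fn0 fs]] smin.
  have div q : J q -> map_poly rho f %| map_poly rho q.
    move=> Jq; apply/modp_eq0P; apply/eqP/negPn/negP => rn0.
    set F := map_poly rho f in fn0 fs rn0 *; set Q := map_poly rho q in rn0 *.
    have : P (size (Q %% F)).
      apply/asboolP; exists (q - map_poly sigma (Q %/ F) * f).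
      have -> : map_poly rho (q - map_poly sigma (Q %/ F) * f) = Q %% F.
        by rewrite rmorphB rmorphM /= mK; apply/eqP; rewrite subr_eq addrC -divp_eq.
      by split=> //; apply: ideal_sub => //; apply: JM.
    by move=> /smin; rewrite -fs leqNgt ltn_modp fn0.
  have [s1|sn1] := eqVneq (size (map_poly rho f)) 1.
    have /size_poly1P[c cn0 fc] : size (map_poly rho f) == 1 by rewrite s1.
    exists ((sigma c^-1)%:P * f); first exact: JM.
    by rewrite rmorphM /= map_polyC /= sK fc -polyCM mulVf.
  have /closed_rootP[b fb] := sn1.
  case: nob; exists b => q /div fq; apply/eqP.
  exact: (root_dvdp fq fb).
set e := (size G).-1.
have sG : size G = e.+1 by rewrite prednK // lt0n size_poly_eq0 monic_neq0.
have e0 : (0 < e)%N.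
  rewrite lt0n; apply/eqP => e_eq0; move: sG; rewrite e_eq0 => sG1.
  have G1 : G = 1.
    by rewrite [LHS]size1_polyC ?sG1 //; move/monicP: Gm; rewrite lead_coefE sG1 => ->.
  have /eqP := Jc 1 (eq_ind _ J JG _ G1).
  by rewrite rmorph1 oner_eq0.
pose r (i : 'I_e) := Pdiv.Ring.rmodp (f * 'X^i) G.
have sr i : (size (r i) <= e)%N.
  by rewrite -ltnS -sG Pdiv.Ring.ltn_rmodp monic_neq0.
have rE i : r i = f * 'X^i - Pdiv.Ring.rdivp (f * 'X^i) G * G.
  by apply/eqP; rewrite eq_sym subr_eq addrC -(Pdiv.RingMonic.rdivp_eq Gm).
pose M := \matrix_(i < e, j < e) (r i)`_j.
have JM1 i : J (\sum_j (M i j)%:P * 'X^j).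
  suff -> : \sum_j (M i j)%:P * 'X^j = r i.
    rewrite rE; apply: (ideal_sub idJ); last exact: JM.
    by rewrite mulrC; apply: JM.
  transitivity (\poly_(j < e) (r i)`_j).
    by rewrite poly_def; apply: eq_bigr => j _; rewrite mxE mul_polyC.
  apply/polyP => l; rewrite coef_poly; case: ltnP => // h.
  by rewrite nth_default // (leq_trans (sr i)).
(* Row 0 of the identity between adj M times M and det M times 1 writes det M as a combination of
   the [r i], which lie in [J]. *)
have Jdet : J (\det M)%:P.
  have -> : (\det M)%:P =
      \sum_i (\adj M (Ordinal e0) i)%:P * \sum_j (M i j)%:P * 'X^j.
    under eq_bigr do rewrite mulr_sumr; rewrite exchange_big /=.
    transitivity (\sum_j (((\adj M *m M) (Ordinal e0) j)%:P * 'X^j : {poly A})).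
      rewrite mul_adj_mx (bigD1 (Ordinal e0)) //= big1 => [|j /negPf jn0].
        by rewrite addr0 mxE eqxx mulr1n expr0 mulr1.
      by rewrite mxE eq_sym jn0 mulr0n polyC0 mul0r.
    apply: eq_bigr => j _; rewrite mxE rmorph_sum mulr_suml /=.
    by apply: eq_bigr => i _; rewrite polyCM mulrA.
  by apply: (ideal_sum idJ) => i _; apply: JM; apply: JM1.
have := Jc _ Jdet; rewrite -det_map_mx.
suff -> : map_mx rho M = 1%:M by rewrite det1; apply/eqP/oner_neq0.
apply/matrixP => i j; rewrite !mxE.
have -> : rho (r i)`_j = (map_poly rho (r i))`_j by rewrite coef_map.
suff -> : map_poly rho (r i) = 'X^i by rewrite coefXn eq_sym.
have sG' : size (map_poly rho G) = e.+1.
  by rewrite size_map_poly_id0 ?sG // (monicP Gm) rmorph1 oner_neq0.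
have <- : map_poly rho (r i) %% map_poly rho G = map_poly rho (r i).
  rewrite modp_small // sG' ltnS; apply: leq_trans (sr i).
  by rewrite size_poly.
rewrite rE rmorphB !rmorphM /= f1 mul1r map_polyXn modpD modpN.
by rewrite modp_mull oppr0 addr0 modp_small // size_polyXn sG' ltnS ltn_ord.
Qed.

Definition generated (A : comNzRingType) (u : nat -> A) (N : nat) (x : A) :=
  exists c : nat -> A, x = \sum_(i < N) c i * u i.

Lemma generated_ideal (A : comNzRingType) (u : nat -> A) (N : nat) :
  ideal_pred (generated u N).
Proof.
split.
- by exists (fun=> 0); rewrite big1 // => i _; rewrite mul0r.
- move=> _ _ [c ->] [d ->]; exists (fun i => c i + d i).
  by rewrite -big_split; apply: eq_bigr => i _; rewrite mulrDl.
- move=> a _ [c ->]; exists (fun i => a * c i).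
  by rewrite mulr_sumr; apply: eq_bigr => i _; rewrite mulrA.
Qed.

Lemma generated_self (A : comNzRingType) (u : nat -> A) (N i : nat) :
  (i < N)%N -> generated u N (u i).
Proof.
move=> lt_iN; exists (fun j => (j == i)%:R).
rewrite (bigD1 (Ordinal lt_iN)) //= eqxx mul1r big1 ?addr0 // => j /negPf jn.
by rewrite -[X in X == _]/(val j) -[X in _ == X]/(val (Ordinal lt_iN)) val_eqE jn mul0r.
Qed.

Lemma generated_sub (A : comNzRingType) (u : nat -> A) (N : nat) (I : A -> Prop) :
  ideal_pred I -> (forall i, (i < N)%N -> I (u i)) ->
  forall x, generated u N x -> I x.
Proof.
move=> idI uI _ [c ->]; have [_ _ IM] := idI.
by apply: (ideal_sum idI) => i _; apply: IM; apply: uI.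
Qed.

(* The ascending chain condition, phrased on sequences of elements. *)
Definition noetherian (A : comNzRingType) :=
  forall u : nat -> A, exists N, generated u N (u N).

Lemma noetherian_field (k : fieldType) : noetherian k.
Proof.
move=> u; have [u0|u0] := eqVneq (u 0) 0.
  by exists 0; exists u; rewrite big_ord0.
by exists 1%N; exists (fun=> u 1 / u 0); rewrite big_ord1 divfK.
Qed.

Lemma noetherian_surj (A B : comNzRingType) (phi : {rmorphism A -> B}) :
  (forall b, exists a, phi a = b) -> noetherian A -> noetherian B.
Proof.
move=> surj nA u; have [v vE] := choice (fun n => surj (u n)).
have [N [c cE]] := nA v; exists N; exists (phi \o c).
by rewrite -vE cE rmorph_sum; apply: eq_bigr => i _; rewrite rmorphM /= vE.
Qed.

(* Hilbert's argument: elements chosen greedily of minimal degree have leading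
   coefficients violating the chain condition. *)
Lemma noetherian_poly (A : comNzRingType) :
  noetherian A -> noetherian {poly A}.
Proof.
move=> nA f; apply: contrapT => bad.
pose I q := exists N, generated f N q.
have genW M N q : (M <= N)%N -> generated f M q -> generated f N q.
  move=> leMN; apply: (generated_sub (generated_ideal f N)) => i ltiM.
  by apply: generated_self; apply: leq_trans leMN.
have idI : ideal_pred I.
  split; first by exists 0; exists f; rewrite big_ord0.
  - move=> x y [M xM] [N yN]; exists (maxn M N).
    have [_ gD _] := generated_ideal f (maxn M N).
    by apply: gD; [apply: genW xM | apply: genW yN]; rewrite ?leq_maxl ?leq_maxr.
  - move=> a x [M xM]; exists M.
    by have [_ _ gM] := generated_ideal f M; apply: gM.
have /choice[next nextP] : forall s : seq {poly A}, exists r,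
    (forall i, I s`_i) ->
    [/\ I r, ~ generated (nth 0 s) (size s) r &
      forall q, I q -> ~ generated (nth 0 s) (size s) q ->
         (size r <= size q)%N].
  move=> s.
  have [sI|] := pselect (forall i, I s`_i); last by exists 0.
  pose P l := `[< exists q, [/\ I q, ~ generated (nth 0 s) (size s) q &
                       size q = l] >].
  have exP : exists l, P l.
    have [N sN] : exists N, forall i, (i < size s)%N -> generated f N s`_i.
      elim: (size s) => [|m [N NP]]; first by exists 0.
      have [M MP] := sI m; exists (maxn M N) => i; rewrite ltnS leq_eqVlt.
      case/predU1P => [->|/NP]; last by apply: genW; rewrite leq_maxr.
      by apply: genW MP; rewrite leq_maxl.
    exists (size (f N)); apply/asboolP; exists (f N); split=> //.
      by exists N.+1; apply: generated_self.
    move=> gN; apply: bad; exists N.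
    exact: (generated_sub (generated_ideal f N) sN).
  case: (ex_minnP exP) => l /asboolP[q [Iq gq <-]] qmin; exists q => _.
  split=> // q' Iq' gq'; apply: qmin; apply/asboolP.
  by exists q'.
pose S := fix S n := if n is m.+1 then rcons (S m) (next (S m)) else [::].
pose g n := next (S n).
have sS n : size (S n) = n by elim: n => //= n IHn; rewrite size_rcons IHn.
have nS n i : (i < n)%N -> (S n)`_i = g i.
  elim: n => //= n IHn; rewrite ltnS nth_rcons sS leq_eqVlt => /predU1P[->|lin].
    by rewrite ltnn eqxx.
  by rewrite lin IHn.
have SI n i : I (S n)`_i.
  elim: n i => [|n IHn] i /=; first by rewrite nth_nil; case: idI.
  rewrite nth_rcons sS; case: ltnP => // _; case: eqP => _; last by case: idI.
  by case: (nextP _ IHn).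
have genE n q : generated (nth 0 (S n)) (size (S n)) q <-> generated g n q.
  rewrite sS; split=> -[c ->]; exists c; apply: eq_bigr => i _; by rewrite nS.
have gI n : I (g n) by case: (nextP _ (SI n)).
have gN n : ~ generated g n (g n) by case: (nextP _ (SI n)) => _ /genE.
have gmin n q : I q -> ~ generated g n q -> (size (g n) <= size q)%N.
  by move=> Iq gq; case: (nextP _ (SI n)) => _ _; apply=> // /genE.
have gmono m n : (m <= n)%N -> (size (g m) <= size (g n))%N.
  move=> lemn; apply: gmin => // gm; apply: (gN n).
  move: gm; apply: (generated_sub (generated_ideal g n)) => i lim.
  by apply: generated_self; apply: leq_trans lemn.
have [N [c cE]] := nA (fun n => lead_coef (g n)).
(* [h] has the same leading term as [g N], so [g N - h] is a shorter element of [I] that the earlier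
   [g i] still do not generate, against the greedy choice. *)
pose h := \sum_(i < N) ((c i)%:P * 'X^(size (g N) - size (g i))) * g i.
have hg : generated g N h by exists (fun i => (c i)%:P * 'X^(size (g N) - size (g i))).
have gn0 n : g n != 0.
  apply/eqP => g0; apply: (gN n); rewrite g0.
  by have [] := generated_ideal g n.
have Igh : I (g N - h).
  apply: (ideal_sub idI) => //; move: hg.
  by apply: (generated_sub idI) => i _.
have ngh : ~ generated g N (g N - h).
  move=> gh; apply: (gN N); rewrite -(subrK h (g N)).
  by have [_ gD _] := generated_ideal g N; apply: gD.
have := gmin _ _ Igh ngh; apply/negP; rewrite -ltnNge.
have hj j : (size (g N) <= j.+1)%N -> h`_j = if j == (size (g N)).-1 then lead_coef (g N) else 0.
  move=> lej; rewrite coef_sum; case: eqP => [jE|jN].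
    rewrite cE; apply: eq_bigr => i _; rewrite -mulrA coefCM; congr (_ * _).
    rewrite coefXnM.
    have lei := gmono _ _ (ltnW (ltn_ord i)).
    have := gn0 i; rewrite -size_poly_gt0 => gi0.
    rewrite ifF; last by apply/negbTE; lia.
    rewrite lead_coefE; congr (_`__).
    lia.
  rewrite big1 // => i _; rewrite -mulrA coefCM coefXnM.
  have lei := gmono _ _ (ltnW (ltn_ord i)).
  case: ltnP => _; first by rewrite mulr0.
  rewrite nth_default ?mulr0 //; move: lej jN lei; move: (size (g N)) (size (g i)) => a b; lia.
have sgN : (0 < size (g N))%N by rewrite size_poly_gt0.
rewrite -[X in (_ < X)%N](prednK sgN) ltnS; apply/leq_sizeP => j lej.
rewrite coefB hj; last by lia.
case: eqP => [->|jN]; first by rewrite lead_coefE subrr.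
rewrite nth_default ?subr0 //.
by move: sgN lej jN; move: (size (g N)) => a; lia.
Qed.

Local Notation widen := (widen_ord (leqnSn _)).

Lemma mcoeff_pihomog (n d : nat) (A : nzRingType) (p : {mpoly A[n]}) m :
  (pihomog mdeg d p)@_m = if mdeg m == d then p@_m else 0.
Proof.
have -> : (pihomog mdeg d p)@_m =
    \sum_(m' <- msupp p | mdeg m' == d) p@_m' * (m' == m)%:R.
  rewrite pihomogE raddf_sum /=; apply: eq_bigr => m' _.
  by rewrite mcoeffZ mcoeffX.
have [pm|] := boolP (m \in msupp p); last first.
  move=> pm; rewrite big_seq_cond big1 => [|m' /andP[pm' _]].
    by rewrite memN_msupp_eq0 // if_same.
  case: eqP => [E|]; last by rewrite mulr0.
  by move: pm; rewrite -E pm'.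
rewrite big_mkcond (bigD1_seq m) ?msupp_uniq //= big1 => [|m' /negPf mn].
  by rewrite eqxx mulr1 addr0.
by rewrite mn mulr0 if_same.
Qed.

(** * Separating the last variable *)

Section Join.

Variables (k : fieldType) (n : nat).

(** Inverts [muni], sending the outer indeterminate to the last variable. Being a composite of two
    ring morphisms, it inherits the morphism structure. *)
Definition mjoin : {poly {mpoly k[n]}} -> {mpoly k[n.+1]} :=
  horner_eval 'X_ord_max \o map_poly (@mwiden n k).

HB.instance Definition _ := GRing.RMorphism.copy mjoin
  (horner_eval (mpolyX k U_(ord_max)) \o map_poly (@mwiden n k)).

Definition mrestr (m : 'X_{1..n.+1}) : 'X_{1..n} :=
  [multinom m (widen i) | i < n].

Lemma mnm_split (m : 'X_{1..n.+1}) :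
  m = (mnmwiden (mrestr m) + U_(ord_max) *+ m ord_max)%MM.
Proof.
apply/mnmP => i; rewrite mnmDE mulmnE mnm1E.
have [<-|] := eqVneq ord_max i.
  by rewrite mnmwiden_ordmax mul1n.
case: (unliftP ord_max i) => [j ->|->]; last by rewrite eqxx.
have -> : lift ord_max j = widen j.
  by apply: val_inj; rewrite /= /bump leqNgt ltn_ord.
by move=> _; rewrite mnmwiden_widen mnmE mul0n addn0.
Qed.

Lemma mdeg_widen (m : 'X_{1..n}) : mdeg (mnmwiden m) = mdeg m.
Proof.
rewrite !mdegE big_ord_recr /= mnmwiden_ordmax addn0.
by apply: eq_bigr => i _; rewrite mnmwiden_widen.
Qed.

Lemma mdeg_split (m : 'X_{1..n.+1}) : mdeg m = (mdeg (mrestr m) + m ord_max)%N.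
Proof.
by rewrite {1}(mnm_split m) mdegD mdegMn mdeg1 mul1n mdeg_widen.
Qed.

Lemma mjoinC (a : {mpoly k[n]}) : mjoin a%:P = mwiden a.
Proof. by rewrite /mjoin /= /horner_eval map_polyC hornerC. Qed.

Lemma mjoin_muni (p : {mpoly k[n.+1]}) : mjoin (muni p) = p.
Proof.
rewrite muniE [RHS]mpolyE raddf_sum; apply: eq_bigr => m _.
rewrite -mul_polyC /= rmorphM /= mjoinC mwidenZ mwidenX -scalerAl; congr (_ *: _).
rewrite [in RHS](mnm_split m) mpolyXD -mpolyXn; congr (_ * _).
by rewrite /mjoin /= /horner_eval map_polyXn hornerXn.
Qed.

Lemma meval_mwiden (x : 'I_n.+1 -> k) (a : {mpoly k[n]}) :
  (mwiden a).@[x] = a.@[fun i => x (widen i)].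
Proof.
rewrite {1}(mpolyE a) [RHS]mevalE (raddf_sum (@mwiden n k)) (raddf_sum (meval x)).
apply: eq_bigr => m _ /=.
rewrite mwidenZ mevalZ mwidenX mevalX big_ord_recr /= mnmwiden_ordmax expr0 mulr1.
by congr (_ * _); apply: eq_bigr => i _; rewrite mnmwiden_widen.
Qed.

Lemma meval_mjoin (x : 'I_n.+1 -> k) (q : {poly {mpoly k[n]}}) :
  (mjoin q).@[x] = (map_poly (meval (fun i => x (widen i))) q).[x ord_max].
Proof.
rewrite -{1}(coefK q) poly_def !raddf_sum /= horner_coef.
rewrite (big_ord_widen (size q)
  (fun i => (map_poly (meval (fun i => x (widen i))) q)`_i * x ord_max ^+ i)).
  rewrite [RHS]big_mkcond; apply: eq_bigr => i _.
  rewrite -mul_polyC /= !rmorphM rmorphXn /= mjoinC meval_mwiden.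
  have -> : mjoin 'X = 'X_ord_max.
    by rewrite /mjoin /= /horner_eval map_polyX hornerX.
  rewrite rmorphXn /= mevalXU coef_map.
  case: ltnP => // h; apply/eqP; rewrite mulf_eq0; apply/orP; left.
  by move: (leq_sizeP _ _ h i (leqnn i)); rewrite coef_map => ->.
exact: size_poly.
Qed.

End Join.

Lemma noetherian_mpoly (k : fieldType) (n : nat) : noetherian {mpoly k[n]}.
Proof.
elim: n => [|n IHn].
  apply: (noetherian_surj (phi := @mpolyC 0 k)) (@noetherian_field k) => p.
  by exists (p@_0%MM); apply/esym/nvar0_mpolyC.
have nP : noetherian {poly {mpoly k[n]}} by apply: noetherian_poly.
apply: (@noetherian_surj {poly {mpoly k[n]}} {mpoly k[n.+1]} (@mjoin k n) _ nP).
move=> p; by exists (muni p); apply: mjoin_muni.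
Qed.

(** * Weighted orders at the origin *)

Section WeightedOrder.

Variables (k : fieldType) (n : nat) (w : 'I_n -> nat).

Definition wdeg (m : 'X_{1..n}) : nat := (\sum_i w i * m i)%N.

(** Membership in the ideal spanned by the monomials of weight at least [t]. A predicate rather than
    a number, since 0 has every order. *)
Definition worder (t : nat) (f : {mpoly k[n]}) : Prop :=
  forall m, f@_m != 0 -> (t <= wdeg m)%N.

Lemma wdegD m1 m2 : wdeg (m1 + m2)%MM = (wdeg m1 + wdeg m2)%N.
Proof.
by rewrite /wdeg -big_split; apply: eq_bigr => i _; rewrite mnmDE mulnDr.
Qed.

Lemma wdegU i : wdeg U_(i)%MM = w i.
Proof.
rewrite /wdeg (bigD1 i) //= mnm1E eqxx muln1 big1 ?addn0 // => j /negPf jn.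
by rewrite mnm1E eq_sym jn muln0.
Qed.

Lemma worder0 t : worder t 0.
Proof. by move=> m; rewrite mcoeff0 eqxx. Qed.

Lemma worder_leq0 f : worder 0 f.
Proof. by []. Qed.

Lemma worderW s t f : (s <= t)%N -> worder t f -> worder s f.
Proof. by move=> le_st tf m /tf; apply: leq_trans. Qed.

Lemma worderD t f g : worder t f -> worder t g -> worder t (f + g).
Proof.
move=> tf tg m; rewrite mcoeffD.
by have [->|/tf//] := eqVneq f@_m 0; rewrite add0r => /tg.
Qed.

Lemma worder_sum t (T : Type) (s : seq T) (Q : pred T) F :
  (forall i, Q i -> worder t (F i)) -> worder t (\sum_(i <- s | Q i) F i).
Proof. by move=> h; apply: big_ind => //; [apply: worder0 | apply: worderD]. Qed.

Lemma worderM s t f g : worder s f -> worder t g -> worder (s + t) (f * g).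
Proof.
move=> sf tg m; rewrite mcoeffM => fg.
have [[l /eqP lm]|h] := pselect (exists2 l : 'X_{1..n < (mdeg m).+1, (mdeg m).+1},
    m == (l.1 + l.2)%MM & f@_l.1 * g@_l.2 != 0).
  rewrite mulf_eq0 negb_or => /andP[/sf ? /tg ?].
  by rewrite [m in wdeg m]lm wdegD; apply: leq_add.
move: fg; rewrite big1 ?eqxx // => l lm; apply/eqP/negPn/negP => ?.
by apply: h; exists l.
Qed.

Lemma worderX t m : (t <= wdeg m)%N -> worder t 'X_[m].
Proof.
by move=> tm m'; rewrite mcoeffX; have [<-|] := eqVneq m m'; rewrite ?eqxx.
Qed.

End WeightedOrder.

(** * Homogeneous Nullstellensatz *)

Lemma ideal_mpoly (k : fieldType) n (I : {mpoly k[n]} -> Prop) f :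
  ideal_pred I -> (forall m, f@_m != 0 -> I 'X_[m]) -> I f.
Proof.
move=> idI fI; rewrite (mpolyE f) big_seq; apply: (ideal_sum idI) => m.
by rewrite mcoeff_msupp -mul_mpolyC => /fI; case: idI => _ _; apply.
Qed.

(** In a form of degree [s] the only monomial of degree [s] in the last variable is the pure power,
    so the leading coefficient is a constant. *)
Lemma muni_monic (k : fieldType) n (s : nat) (g : {mpoly k[n.+1]}) :
  g \is s.-homog -> g@_(U_(ord_max) *+ s) = 1 ->
  muni g \is monic.
Proof.
move=> /dhomogP gs' g1; have gs m : m \in msupp g -> mdeg m = s := gs' m.
set m0 := (_ *+ s)%MM in g1.
have m0max : m0 ord_max = s by rewrite mulmnE mnm1E eqxx mul1n.
have m0r : mrestr m0 = 0%MM.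
  apply/mnmP => i; rewrite mnmE mulmnE mnm1E mnm0E.
  by rewrite -val_eqE /= gtn_eqF.
have m0P m : m \in msupp g -> m ord_max = s -> m = m0.
  move=> /gs; rewrite mdeg_split => ms mmax.
  have : mdeg (mrestr m) == 0%N by lia.
  rewrite mdeg_eq0 => /eqP mr.
  by rewrite (mnm_split m) mr mmax mnmwiden0 add0m.
have coef j : (muni g)`_j = \sum_(m <- msupp g)
    (g@_m *: 'X_[mrestr m]) * (j == m ord_max)%:R.
  rewrite muniE coef_sum; apply: eq_bigr => m _.
  by rewrite coefZ coefXn.
have cs : (muni g)`_s = 1.
  rewrite coef (bigD1_seq m0) ?msupp_uniq //=; last first.
    by rewrite mcoeff_msupp g1 oner_neq0.
  rewrite m0max eqxx mulr1 g1 m0r scale1r mpolyX0 big_seq_cond big1 ?addr0 //.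
  move=> m /andP[mg /negPf mn]; case: eqP => [/esym/(m0P _ mg)/eqP|].
    by rewrite mn.
  by rewrite mulr0.
have sg : (size (muni g) <= s.+1)%N.
  apply/leq_sizeP => j lej; rewrite coef big_seq big1 // => m /gs.
  rewrite mdeg_split => ms; rewrite (_ : j == _ = false) ?mulr0 //.
  by apply/negbTE; lia.
have sgE : size (muni g) = s.+1.
  apply/eqP; rewrite eqn_leq sg ltnNge; apply/negP => /leq_sizeP/(_ s (leqnn _)).
  by rewrite cs => /eqP; rewrite oner_eq0.
by apply/monicP; rewrite lead_coefE sgE.
Qed.

Lemma pihomog_mwiden (k : fieldType) n (a : {mpoly k[n]}) t :
  pihomog mdeg t (mwiden a) = mwiden (pihomog mdeg t a).
Proof.
elim/mpolyind: a => [|c m p _ _ IHp]; first by rewrite !(raddf0, mwiden0).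
rewrite mwidenD mwidenZ mwidenX !pihomogD !linearZ /= !pihomogX /= mdeg_widen IHp.
by rewrite mwidenD; case: eqP => _; rewrite mwidenZ ?mwidenX ?mwiden0.
Qed.

(* Induction on the number of variables: either (0, ..., 0, 1) is a common
   zero, or the ideal contains a form monic in the last variable and every zero
   of the elimination ideal extends. *)
Lemma homogeneous_nullstellensatz (k : closedFieldType) (n : nat)
    (I : {mpoly k[n]} -> Prop) :
  ideal_pred I -> (forall f s, I f -> I (pihomog mdeg s f)) ->
  (forall x : 'I_n -> k, (forall f, I f -> f.@[x] = 0) -> forall i, x i = 0) ->
  exists N, forall m, (N <= mdeg m)%N -> I 'X_[m].
Proof.
elim: n I => [|n IHn] I idI homI zI.
  by exists 1%N => m; rewrite nvar0_mnmE mdeg0.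
have [I0 ID IM] := idI.
have [f [s [If fs]]] : exists f s, I f /\ f@_(U_(ord_max) *+ s) != 0.
  apply: contrapT => nof.
  pose x0 (i : 'I_n.+1) : k := (i == ord_max)%:R.
  have /(_ ord_max) : forall i, x0 i = 0.
    apply: zI => f If; rewrite mevalE big1 // => m _.
    have [ms|nms] := pselect (forall i, i != ord_max -> m i = 0%N).
      have -> : m = (U_(ord_max) *+ m ord_max)%MM.
        apply/mnmP => i; rewrite mulmnE mnm1E eq_sym.
        have [->|ni] := eqVneq i ord_max; first by rewrite mul1n.
        by rewrite mul0n; apply: ms.
      set m' := (_ *+ _)%MM.
      have [->|fm] := eqVneq f@_m' 0; first by rewrite mul0r.
      by case: nof; exists f, (m ord_max).
    have [i [/negPf ni mi]] : exists i, i != ord_max /\ m i != 0%N.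
      apply: contrapT => noi; apply: nms => i ni; apply/eqP/negPn/negP => mi.
      by apply: noi; exists i.
    by rewrite (bigD1 i) //= /x0 ni expr0n (negPf mi) mul0r mulr0.
  by rewrite /x0 eqxx => /eqP; rewrite oner_eq0.
pose g := (f@_(U_(ord_max) *+ s))^-1 *: pihomog mdeg s f.
have Ig : I g by rewrite /g -mul_mpolyC; apply: IM; apply: homI.
have gs : g \is s.-homog by apply: rpredZ; apply: pihomogP.
have g1 : g@_(U_(ord_max) *+ s) = 1.
  by rewrite mcoeffZ mcoeff_pihomog mdegMn mdeg1 mul1n eqxx mulVf.
have gm := muni_monic gs g1.
pose I' a := I (mwiden a).
have idI' : ideal_pred I'.
  split; rewrite /I'; first by rewrite mwiden0.
  - by move=> a b Ia Ib; rewrite mwidenD; apply: ID.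
  - by move=> a b Ib; rewrite mwidenM; apply: IM.
have homI' a t : I' a -> I' (pihomog mdeg t a).
  move=> /(homI _ t); rewrite /I'; congr (I _).
  exact: pihomog_mwiden.
have zI' x : (forall a, I' a -> a.@[x] = 0) -> forall i, x i = 0.
  move=> xI'.
  (* [J] is [I] read as an ideal of polynomials in the last variable; its constants form [I'], and
     evaluation at [x] is the morphism above which a zero is sought. *)
  pose J q := I (mjoin q).
  have idJ : ideal_pred J.
    split; rewrite /J; first by rewrite rmorph0.
    - by move=> p q Jp Jq; rewrite rmorphD; apply: ID.
    - by move=> p q Jq; rewrite rmorphM; apply: IM.
  have [|||b bJ] := @ideal_root_above _ _ (meval x) (@mpolyC n k) J (muni g) _ idJ _ gm.
  - by move=> c /=; rewrite mevalC.
  - by rewrite /J mjoin_muni.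
  - by move=> a; rewrite /J mjoinC => /xI'.
  - pose y (i : 'I_n.+1) := if unlift ord_max i is Some j then x j else b.
    have yw j : y (widen j) = x j.
      have -> : widen j = lift ord_max j.
        by apply: val_inj; rewrite /= /bump leqNgt ltn_ord.
      by rewrite /y liftK.
    have ym : y ord_max = b by rewrite /y unlift_none.
    move=> i; rewrite -yw; apply: zI => h Ih.
    rewrite -(mjoin_muni h) meval_mjoin ym -[RHS](bJ (muni h)); last first.
      by rewrite /J mjoin_muni.
    congr (_.[_]); apply: eq_map_poly => a; apply: meval_eq => j.
    exact: yw.
have [N NP] := IHn _ idI' homI' zI'.
(* The weight is the degree in the first n variables. Since [g] is monic of degree [s] in the last
   variable Y, Y^s - g has weight at least 1; so modulo [I] the power Y^(s u) is congruent to
   something of weight at least u, which for u = N lies in [I]. *)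
pose w (i : 'I_n.+1) : nat := i != ord_max.
have wE m : wdeg w m = mdeg (mrestr m).
  rewrite /wdeg big_ord_recr /= {2}/w eqxx mul0n addn0 mdegE.
  apply: eq_bigr => i _; rewrite mnmE /w -val_eqE /= ltn_eqF ?mul1n //.
have wI h : worder w N h -> I h.
  move=> hN; apply: ideal_mpoly => // m /hN; rewrite wE => /NP.
  rewrite /I' mwidenX => Im; rewrite (mnm_split m) mpolyXD mulrC.
  exact: IM.
have powI u : exists2 h, I ('X_ord_max ^+ (s * u) - h) & worder w u h.
  elim: u => [|u [h Ih hu]].
    by exists 1; rewrite ?muln0 ?expr0 ?subrr.
  exists (h * ('X_ord_max ^+ s - g)).
    rewrite mulnS exprD -[X in I X](subrK (h * 'X_ord_max ^+ s)).
    set Y := 'X_ord_max.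
    have -> : Y ^+ s * Y ^+ (s * u) - h * (Y ^+ s - g) - h * Y ^+ s + h * Y ^+ s
      = Y ^+ s * (Y ^+ (s * u) - h) + h * g by ring.
    by apply: ID; apply: IM.
  rewrite -[X in worder _ X](addn1 u); apply: worderM => // m.
  rewrite mcoeffB mpolyXn mcoeffX.
  have [<-|nm] := eqVneq (U_(ord_max) *+ s)%MM m; first by rewrite g1 subrr eqxx.
  rewrite sub0r oppr_eq0 -mcoeff_msupp => /(dhomog_mf gs) /=; rewrite wE.
  rewrite lt0n mdeg_eq0 => ms; apply/eqP => mr.
  move: ms; rewrite mdeg_split mr mdeg0 add0n => ms.
  by move/eqP: nm; apply; rewrite (mnm_split m) mr ms mnmwiden0 add0m.
have Iy : I ('X_ord_max ^+ (s * N)).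
  have [h Ih hN] := powI N; rewrite -(subrK h ('X_ord_max ^+ _)).
  by apply: ID => //; apply: wI.
(* A monomial of this degree has degree at least N in the first n variables or exponent at least s N
   in the last. *)
exists (N + s * N)%N => m mN.
have [le_N|lt_N] := leqP N (mdeg (mrestr m)).
  by apply: wI; apply: worderX; rewrite wE.
rewrite (mnm_split m) mpolyXD -mpolyXn; apply: (IM _ _).
move: mN; rewrite mdeg_split => mN.
rewrite -(subnK (_ : (s * N <= m ord_max)%N)); last lia.
by rewrite exprD; apply: IM.
Qed.

(** * Counting points *)

Lemma exp2_beats_linear (c m : nat) : exists j, ((c + j) * m < 2 ^ j)%N.
Proof.
pose i := (2 * m + c)%N; exists (2 * i)%N.
have h1 : (i < 2 ^ i)%N := ltn_expl i (ltnSn 1).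
have h2 : (4 * m <= 2 ^ i)%N.
  apply: leq_trans (_ : 4 ^ m <= _)%N; last first.
    by rewrite -[4%N]/(2 ^ 2)%N -expnM leq_exp2l // /i leq_addr.
  elim: (m) => // l IHl; rewrite expnS; have : (0 < 4 ^ l)%N by rewrite expn_gt0.
  lia.
rewrite mul2n -addnn expnD.
have : (c + (i + i) <= 3 * i)%N by rewrite /i; lia.
by nia.
Qed.

(** Take u = W v with v = 2^j. Bernoulli gives (1 + 1/W)^W >= 2, so ((W+1)/W)^u >= 2^v, while 1 + u
    N <= 2^(W N + 1 + j); [j] is chosen so that v exceeds m times that exponent. *)
Lemma exp_beats_poly (W N m : nat) :
  exists u, (W ^ u * (1 + u * N) ^ m < W.+1 ^ u)%N.
Proof.
have [->|W0] := posnP W; first by exists 1%N; rewrite exp0n // mul0n.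
pose c := (W * N)%N.
have [j jP] := exp2_beats_linear c.+1 m.
pose v := (2 ^ j)%N; exists (W * v)%N.
have v0 : (0 < v)%N by rewrite expn_gt0.
have base : (2 * W ^ W <= W.+1 ^ W)%N.
  have bern l : ((W + l) * W ^ l <= W * W.+1 ^ l)%N.
    elim: l => [|l IHl]; first by rewrite addn0 !expn0.
    rewrite !expnS; move: IHl; move: (W ^ l)%N (W.+1 ^ l)%N => a b; nia.
  rewrite -(leq_pmul2l W0); apply: leq_trans (bern W).
  by rewrite addnn -mul2n -mulnA mulnCA.
apply: leq_trans (_ : (2 * W ^ W) ^ v <= _)%N; last first.
  by rewrite [X in (_ <= X)%N]expnM leq_exp2r.
rewrite expnMn -expnM mulnC ltn_pmul2r ?expn_gt0 ?W0 //.
apply: leq_ltn_trans (_ : (2 ^ (c.+1 + j)) ^ m < _)%N.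
  have [->|m0] := posnP m; first by rewrite !expn0.
  rewrite leq_exp2r // expnD.
  have : (c.+1 < 2 ^ c.+1)%N := ltn_expl _ (ltnSn 1).
  rewrite -/v; rewrite (_ : (W * v * N = c * v)%N); last by rewrite /c; lia.
  nia.
by rewrite -expnM ltn_exp2l // /v.
Qed.

(** Replaces a limit of x(t + N0) / x(t): if N > W, iterating from t = 1 makes [x] grow at least
    like ((W+1)/W)^u after u shifts, against the polynomial bound. *)
Lemma leq_of_shift_growth (x : nat -> nat) (N W N0 m : nat) :
  (0 < x 1)%N -> (forall t, x t <= t ^ m)%N ->
  (forall t, N * x t <= W * x (t + N0))%N -> (N <= W)%N.
Proof.
move=> x1 xm NW; rewrite leqNgt; apply/negP => ltWN.
have [u uP] := exp_beats_poly W N0 m.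
have step u' : (W.+1 ^ u' * x 1 <= W ^ u' * x (1 + u' * N0))%N.
  elim: u' => [|u' IHu]; first by rewrite !mul1n.
  rewrite !expnS -!mulnA; have := NW (1 + u' * N0)%N.
  rewrite -addnA -mulSnr => h.
  have : (W.+1 * x (1 + u' * N0) <= W * x (1 + u'.+1 * N0))%N.
    by apply: leq_trans h; rewrite leq_mul2r ltWN orbT.
  move: IHu; move: (W.+1 ^ u')%N (W ^ u')%N (x 1) (x (1 + u' * N0)%N) (x (1 + u'.+1 * N0)%N).
  move=> a b c d e h1 h2.
  have h3 : (W.+1 * (a * c) <= W.+1 * (b * d))%N by rewrite leq_mul2l h1 orbT.
  have h4 : (b * (W.+1 * d) <= b * (W * e))%N by rewrite leq_mul2l h2 orbT.
  by apply: leq_trans h3 _; rewrite mulnCA; apply: leq_trans h4 _; rewrite mulnCA.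
have := step u; apply/negP; rewrite -ltnNge.
apply: leq_ltn_trans (_ : W ^ u * (1 + u * N0) ^ m < _)%N.
  by rewrite leq_mul2l xm orbT.
by apply: leq_trans uP _; rewrite leq_pmulr.
Qed.

Lemma linear_dependence (k : fieldType) (T U : finType) (A : T -> U -> k) :
  (#|U| < #|T|)%N ->
  exists c : T -> k, (exists t, c t != 0) /\ forall u, \sum_t c t * A t u = 0.
Proof.
move=> ltUT.
pose M := \matrix_(i < #|T|, j < #|U|) A (enum_val i) (enum_val j).
have : kermx M != 0.
  rewrite kermx_eq0 -row_leq_rank -ltnNge.
  by apply: leq_ltn_trans ltUT; apply: rank_leq_col.
rewrite -nz_row_eq0 => /rV0Pn[i ci].
pose v := nz_row (kermx M).
have vM : v *m M = 0 by apply/sub_kermxP/nz_row_sub.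
exists (fun t => v 0 (enum_rank t)); split.
  by exists (enum_val i); rewrite enum_valK.
move=> u; have := congr1 (fun B : 'rV_ _ => B 0 (enum_rank u)) vM.
rewrite !mxE => E; rewrite -[RHS]E (reindex (@enum_val T T)) /=; last first.
  by apply: onW_bij; apply: enum_val_bij.
by apply: eq_bigr => j _; rewrite enum_valK mxE enum_rankK.
Qed.

Section WeightedCount.

Variables (m : nat) (w : 'I_m -> nat).
Hypothesis w_gt0 : forall i, (0 < w i)%N.

Lemma mdeg_wdeg (a : 'X_{1..m}) : (mdeg a <= wdeg w a)%N.
Proof. by rewrite mdegE; apply: leq_sum => i _; rewrite leq_pmull. Qed.

Lemma card_bmnm_leq t : (#|{: 'X_{1..m < t}}| <= t ^ m)%N.
Proof.
have lt_a (a : 'X_{1..m < t}) i : (a i < t)%N.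
  by apply: leq_ltn_trans (bmdeg a); rewrite mdegE (bigD1 i) //= leq_addr.
pose h (a : 'X_{1..m < t}) : {ffun 'I_m -> 'I_t} := [ffun i => Ordinal (lt_a a i)].
have -> : (t ^ m)%N = #|{ffun 'I_m -> 'I_t}| by rewrite card_ffun !card_ord.
apply: (leq_card h) => a b /ffunP ab; apply/val_inj/mnmP => i.
by have /(congr1 val) := ab i; rewrite !ffunE.
Qed.

(** Dividing each exponent by its weight leaves a quotient of weight at most the original degree,
    and the remainders take prod w_i values: a discrete comparison of the volumes of two
    simplices. *)
Lemma card_bmnm_weighted t :
  (#|{: 'X_{1..m < t}}| <=
   #|[set a : 'X_{1..m < t} | wdeg w a < t]| * \prod_i w i)%N.
Proof.
pose q (a : 'X_{1..m}) : 'X_{1..m} := [multinom (a i %/ w i)%N | i < m].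
have qle a : (wdeg w (q a) <= mdeg a)%N.
  by rewrite mdegE; apply: leq_sum => i _; rewrite mnmE mulnC leq_trunc_div.
have qlt (a : 'X_{1..m < t}) : (mdeg (q a) < t)%N.
  exact: leq_ltn_trans (leq_trans (mdeg_wdeg _) (qle a)) (bmdeg a).
pose qb a := BMultinom (qlt a).
pose rem (a : 'X_{1..m < t}) : {dffun forall i, 'I_(w i)} :=
  [ffun i => Ordinal (ltn_pmod (a i) (w_gt0 i))].
pose Q := [set a : 'X_{1..m < t} | (wdeg w a < t)%N].
have -> : (\prod_i w i)%N = #|{dffun forall i, 'I_(w i)}|.
  rewrite card_dep_ffun foldrE big_map big_enum /=; apply: eq_bigr => i _.
  by rewrite card_ord.
pose h a := (qb a, rem a).
have hinj : injective h.
  move=> a b hab; have /(congr1 val)/mnmP ab : qb a = qb b := congr1 fst hab.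
  have /ffunP rab : rem a = rem b := congr1 snd hab; apply/val_inj/mnmP => i.
  have := ab i; have /(congr1 val) := rab i; rewrite !ffunE /= !mnmE => e1 e2.
  by rewrite (divn_eq (a i) (w i)) (divn_eq (b i) (w i)) e1 e2.
rewrite -cardsT -(card_imset _ hinj) -[X in (_ <= _ * X)%N]cardsT -cardsX.
apply: subset_leq_card; apply/fintype.subsetP => _ /imsetP[a _ ->].
by rewrite !inE /= andbT; apply: leq_ltn_trans (qle a) (bmdeg a).
Qed.

End WeightedCount.

Section MsizeBounds.

Variables (k : fieldType) (n : nat).
Implicit Types p q : {mpoly k[n]}.

Lemma msizeM_bound p q : (msize (p * q) <= (msize p + msize q).-1)%N.
Proof.
have [->|p0] := eqVneq p 0; first by rewrite mul0r msize0.
have [->|q0] := eqVneq q 0; first by rewrite mulr0 msize0.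
by rewrite msizeM.
Qed.

Lemma msize_leqP p s :
  (forall m, p@_m != 0 -> (mdeg m < s)%N) <-> (msize p <= s)%N.
Proof.
split=> [h|h m]; last first.
  by rewrite -mcoeff_msupp => /msize_mdeg_lt/leq_trans; apply.
by rewrite msizeE; apply/bigmax_leqP_seq => m mp _; apply: h; rewrite -mcoeff_msupp.
Qed.

Lemma dhomog_msize_leq p s : p \is s.-homog -> (msize p <= s.+1)%N.
Proof.
move=> ps; apply/msize_leqP => m.
by rewrite -mcoeff_msupp => /(dhomog_mf ps) /= ->.
Qed.

Lemma msize_sum_leq (T : Type) (r : seq T) (Q : pred T) (F : T -> {mpoly k[n]}) s :
  (forall i, Q i -> (msize (F i) <= s)%N) -> (msize (\sum_(i <- r | Q i) F i) <= s)%N.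
Proof.
move=> h; apply: (big_ind (fun p => msize p <= s)%N) => //; first by rewrite msize0.
by move=> p q hp hq; apply: leq_trans (msizeD_le p q) _; rewrite geq_max hp.
Qed.

Lemma pihomog_mul s d p q : q \is d.-homog ->
  pihomog mdeg s (p * q) =
  if (d <= s)%N then pihomog mdeg (s - d) p * q else 0.
Proof.
move=> qd; rewrite {1}(mpolyE p) mulr_suml raddf_sum /=.
have pX m : pihomog mdeg s ('X_[m] * q) = if mdeg m + d == s then 'X_[m] * q else 0.
  have hom : 'X_[m] * q \is (mdeg m + d).-homog.
    have Xd : 'X_[m] \is [in k[n], (mdeg m).-homog] by rewrite dhomogX.
    exact: dhomogM Xd qd.
  case: eqP => [<-|/eqP ne]; first by rewrite pihomog_dE.
  exact: (pihomog_ne0 ne hom).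
case: ifP => ds; last first.
  rewrite big1 // => m _; rewrite -scalerAl linearZ /= pX.
  by case: eqP; rewrite ?scaler0 // => E; move: ds; rewrite -E leq_addl.
rewrite pihomogE mulr_suml [RHS]big_mkcond; apply: eq_bigr => m _.
rewrite -scalerAl linearZ /= pX.
rewrite -(eqn_add2r d) subnK //.
by case: eqP; rewrite ?scaler0.
Qed.

End MsizeBounds.

(* A weighted Bezout bound: [Z] is a finite set of common zeros of polynomials
   [f u] whose leading forms [F u] have degree [om u] and generate all forms of
   large degree, and [f u] has weighted order at least [om u] at every point of
   [Z].  Polynomials of order >= t along [Z] then have codimension at most the
   number of monomials of degree < t + N0, but at least [size Z] times the number
   of monomials of weight < t; compare the growth in [t]. *)
Section WeightedBezout.

Variables (k : fieldType) (m : nat) (w : 'I_m -> nat).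
Hypothesis w_gt0 : forall i, (0 < w i)%N.

(** Taylor expansion f(X + z), so that [worder w t (mshift z f)] expresses weighted vanishing to
    order [t] at [z]. *)
Definition mshift (z : 'rV[k]_m) : {mpoly k[m]} -> {mpoly k[m]} :=
  comp_mpoly [tuple 'X_i + (z 0 i)%:MP | i < m].

HB.instance Definition _ z := GRing.RMorphism.copy (mshift z)
  (comp_mpoly [tuple 'X_i + (z 0 i)%:MP | i < m]).

Lemma mshiftX z i : mshift z 'X_i = 'X_i + (z 0 i)%:MP.
Proof. by rewrite /mshift comp_mpolyXU -tnth_nth tnth_mktuple. Qed.

Lemma mshiftC z c : mshift z c%:MP = c%:MP.
Proof. exact: comp_mpolyC. Qed.

Lemma mshift0 z f : (mshift z f)@_0 = peval f z.
Proof.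
rewrite /mshift comp_mpolyE raddf_sum /peval mevalE; apply: eq_bigr => l _ /=.
rewrite mcoeffZ (rmorph_prod (mcoeff 0%MM)); congr (_ * _).
apply: eq_bigr => i _; rewrite (rmorphXn (mcoeff 0%MM)) /= tnth_mktuple.
by rewrite mcoeffD mcoeffX mnm1_eq0 add0r mcoeffC eqxx mulr1.
Qed.

Lemma worderMl t (f g : {mpoly k[m]}) : worder w t g -> worder w t (f * g).
Proof. exact: worderM (@worder_leq0 _ _ w f). Qed.

Lemma mshiftZ z c f : mshift z (c *: f) = c *: mshift z f.
Proof. by rewrite -!mul_mpolyC rmorphM /= mshiftC. Qed.

Lemma worderZ t c (f : {mpoly k[m]}) : worder w t f -> worder w t (c *: f).
Proof. by rewrite -mul_mpolyC; apply: worderMl. Qed.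

Lemma worder_no_constant t (f : {mpoly k[m]}) :
  (forall i, (t <= w i)%N) -> f@_0 = 0 -> worder w t f.
Proof.
move=> tw f0 l fl; have l0 : l != 0%MM by apply: contraNneq fl => ->; rewrite f0.
move: l0; rewrite -mdeg_eq0 -lt0n => l0; apply: leq_trans (leq_pmulr t l0) _.
rewrite mdegE big_distrr; apply: leq_sum => i _.
exact: leq_mul (tw i) (leqnn _).
Qed.

Lemma worder_gt0 (f : {mpoly k[m]}) : f@_0 = 0 -> worder w 1 f.
Proof. exact: worder_no_constant. Qed.

(** [e] is a unit of the local ring at 0. In h = e h - (e - 1) h the factor e - 1 has order at least
    1, so the known order of h climbs by one until it reaches t. *)
Lemma worder_unit (t : nat) (e h : {mpoly k[m]}) :
  e@_0 = 1 -> worder w t (e * h) -> worder w t h.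
Proof.
move=> e0 eh.
suff S s : (s <= t)%N -> worder w s h by apply: S.
elim: s => // s IHs st.
have -> : h = e * h - (e - 1) * h by ring.
apply: worderD; first exact: worderW eh.
rewrite -mulNr -addn1 addnC; apply: worderM; last by apply: IHs; apply: ltnW.
by apply: worder_gt0; rewrite mcoeffN mcoeffB e0 mcoeff1 eqxx subrr oppr0.
Qed.

Lemma worderXn s (f : {mpoly k[m]}) l : worder w s f -> worder w (s * l) (f ^+ l).
Proof.
move=> fs; elim: l => [|l IHl]; first by rewrite muln0.
by rewrite exprS mulnS; apply: worderM.
Qed.

(** A form of Chinese remaindering: [E] is a product of t-th powers of affine functions, each equal
    to 1 at [z] and to 0 at one other point. As weights are positive, a t-th power has order at
    least [t] there. *)
Lemma separator (Z : seq 'rV[k]_m) (z : 'rV[k]_m) (t : nat) :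
  exists2 E, peval E z = 1 &
    forall z', z' \in Z -> z' != z -> worder w t (mshift z' E).
Proof.
elim: Z => [|y Z [E Ez EZ]].
  by exists 1; rewrite /peval ?meval1.
have [yz|yz] := eqVneq y z.
  by exists E => // z'; rewrite inE yz => /predU1P[->|//]; rewrite ?eqxx //; apply: EZ.
have /rV0Pn[j] : z - y != 0 by rewrite subr_eq0 eq_sym.
rewrite !mxE => zyj.
pose L : {mpoly k[m]} := (z 0 j - y 0 j)^-1 *: ('X_j - (y 0 j)%:MP).
have Lz : peval L z = 1.
  by rewrite /peval mevalZ mevalB mevalXU mevalC mulVf.
have Ly : worder w 1 (mshift y L).
  apply: worder_gt0; rewrite mshift0 /peval mevalZ mevalB mevalXU mevalC.
  by rewrite subrr mulr0.
exists (L ^+ t * E).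
  by move: Lz Ez; rewrite /peval mevalM rmorphXn /= => -> ->; rewrite expr1n mulr1.
move=> z'; rewrite inE rmorphM rmorphXn /= => /predU1P[->|zZ] zz.
  have := worderM (worderXn (l := t) Ly) (@worder_leq0 _ _ w (mshift y E)).
  by rewrite mul1n addn0.
exact: worderMl (EZ _ zZ zz).
Qed.

Variables (Z : seq 'rV[k]_m) (T0 : finType).
Variables (F f : T0 -> {mpoly k[m]}) (om : T0 -> nat) (N0 : nat).
Hypotheses (Z_uniq : uniq Z) (om_gt0 : forall i, (0 < om i)%N).
Hypotheses (F_homog : forall i, F i \is (om i).-homog)
  (f_top : forall i, (msize (f i - F i) <= om i)%N)
  (F_all : forall a, (N0 <= mdeg a)%N ->
     exists b : T0 -> {mpoly k[m]}, 'X_[a] = \sum_i b i * F i)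
  (f_order : forall z i, z \in Z -> worder w (om i) (mshift z (f i))).

Let reducible (t : nat) (h : {mpoly k[m]}) :=
  exists2 r, (msize r <= t + N0)%N &
    forall z, z \in Z -> worder w t (mshift z (h - r)).

Let reducible0 t : reducible t 0.
Proof.
exists 0; rewrite ?msize0 // => z _; rewrite subr0 rmorph0; exact: worder0.
Qed.

Let reducibleD t h1 h2 : reducible t h1 -> reducible t h2 -> reducible t (h1 + h2).
Proof.
move=> [r1 s1 o1] [r2 s2 o2]; exists (r1 + r2).
  by apply: leq_trans (msizeD_le _ _) _; rewrite geq_max s1.
move=> z zZ; rewrite opprD addrACA rmorphD; apply: worderD.
  exact: o1. exact: o2.
Qed.

Let reducibleZ t c h : reducible t h -> reducible t (c *: h).
Proof.
move=> [r s o]; exists (c *: r); first exact: leq_trans (msizeZ_le _ _) s.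
by move=> z zZ; rewrite -scalerBr mshiftZ; apply/worderZ/o.
Qed.

(** Induction on the degree, for all [t] at once. A monomial of high degree is a sum of b_i F_i with
    b_i homogeneous; replacing F_i by f_i changes it in lower degree only. In b_i f_i, reduce b_i at
    order t - om i to some r: then r f_i has small enough degree, and the error (b_i - r) f_i
    regains om i from the order of f_i. *)
Let reducible_all t h : reducible t h.
Proof.
suff mon s : forall t a, (mdeg a < s)%N -> reducible t 'X_[a].
  rewrite (mpolyE h); apply: (big_ind (reducible t)) => // [|a _]; first exact: reducibleD.
  by apply: reducibleZ; apply: (mon (mdeg a).+1).
elim: s => // s IHs {}t a; rewrite ltnS leq_eqVlt => /predU1P[as'|]; last exact: IHs.
have bounded u p : (msize p <= s)%N -> reducible u p.
  move=> /msize_leqP ps; rewrite (mpolyE p) big_seq; apply: (big_ind (reducible u)) => //.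
    exact: reducibleD.
  by move=> b; rewrite mcoeff_msupp => /ps/IHs bu; apply: reducibleZ.
have [lt_s|le_s] := ltnP s (t + N0).
  exists 'X_[a]; first by rewrite msizeX as'.
  by move=> z _; rewrite subrr rmorph0; apply: worder0.
have [|b0 ab0] := F_all (a := a).
  by rewrite as'; apply: leq_trans le_s; apply: leq_addl.
pose b i := if (om i <= s)%N then pihomog mdeg (s - om i) (b0 i) else 0.
have aE : 'X_[a] = \sum_i b i * F i.
  have <- : pihomog mdeg s 'X_[a] = 'X_[a] :> {mpoly k[m]}.
    by rewrite pihomogX /= as' eqxx.
  rewrite ab0 raddf_sum; apply: eq_bigr => i _.
  rewrite /= (pihomog_mul _ _ (F_homog i)) /b; case: ifP => //.
  by rewrite mul0r.
have sb i : (msize (b i) <= s.+1 - om i)%N.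
  rewrite /b; case: ifP => // le_i; last by rewrite msize0.
  by rewrite subSn //; apply: dhomog_msize_leq; apply: pihomogP.
have -> : 'X_[a] = \sum_i b i * f i + (-1) *: \sum_i b i * (f i - F i).
  rewrite scaleN1r aE -sumrB; apply: eq_bigr => i _.
  by rewrite mulrBr opprB addrC subrK.
apply: reducibleD; last first.
  apply: reducibleZ; apply: bounded; apply: msize_sum_leq => i _.
  have [->|b0n] := eqVneq (b i) 0; first by rewrite mul0r msize0.
  apply: leq_trans (msizeM_bound _ _) _.
  have := sb i; have := f_top i; have := om_gt0 i.
  have : (0 < msize (b i))%N by rewrite lt0n msize_poly_eq0.
  move: (msize (b i)) (msize (f i - F i)) (om i) => x y z; lia.
apply: (big_ind (reducible t)) => // [|i _]; first exact: reducibleD.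
have [le_om|lt_om] := leqP (om i) t; last first.
  exists 0; rewrite ?msize0 // => z zZ; rewrite subr0 rmorphM /=.
  by apply: worderW (ltnW lt_om) _; apply: worderMl; apply: f_order.
have [|r rs ro] := bounded (t - om i)%N (b i).
  by apply: leq_trans (sb i) _; have := om_gt0 i; lia.
exists (r * f i).
  apply: leq_trans (msizeM_bound _ _) _.
  have sf : (msize (f i) <= (om i).+1)%N.
    rewrite -(subrK (F i) (f i)); apply: leq_trans (msizeD_le _ _) _.
    by rewrite geq_max (leqW (f_top i)) (dhomog_msize_leq (F_homog i)).
  by move: sf rs le_om; move: (msize r) (msize (f i)) (om i) => x y z; lia.
move=> z zZ; rewrite -mulrBl rmorphM /= -(subnK le_om).
by apply: worderM; [apply: ro | apply: f_order].
Qed.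

(** The products of a separator at z with a monomial in X - z of weight below t are independent
    modulo order t along [Z]. Otherwise their low-degree remainders [r] would satisfy a relation;
    localized at one point, it would say that a unit times a nonzero combination of monomials of
    weight below t has order t. *)
Let weighted_count t :
  (size Z * #|[set a : 'X_{1..m < t} | wdeg w a < t]%N| <= #|{: 'X_{1..m < t + N0}}|)%N.
Proof.
set Q := [set a : 'X_{1..m < t} | (wdeg w a < t)%N].
rewrite leqNgt; apply/negP => lt.
pose zz (i : 'I_(size Z)) := tnth (in_tuple Z) i.
have zzZ i : zz i \in Z by apply: mem_tnth.
have zz_inj : injective zz.
  move=> i j; rewrite /zz !(tnth_nth 0) /= => /eqP.
  by rewrite nth_uniq // => /eqP/val_inj.
have /choice[E EP] : forall i, exists E, peval E (zz i) = 1 /\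
    forall z', z' \in Z -> z' != zz i -> worder w t (mshift z' E).
  by move=> i; have [E E1 E2] := separator Z (zz i) t; exists E.
pose cen i (a : 'X_{1..m}) : {mpoly k[m]} :=
  \prod_j ('X_j - ((zz i) 0 j)%:MP) ^+ a j.
have cenE i a : mshift (zz i) (cen i a) = 'X_[a].
  rewrite rmorph_prod mpolyXE_id; apply: eq_bigr => j _.
  by rewrite rmorphXn rmorphB /= mshiftX mshiftC addrK.
pose T : finType := ('I_(size Z) * {a : 'X_{1..m < t} | a \in Q})%type.
pose B (x : T) := E x.1 * cen x.1 (val x.2).
have /choice[r rP] : forall x, exists r, (msize r <= t + N0)%N /\
    forall z, z \in Z -> worder w t (mshift z (B x - r)).
  by move=> x; have [r r1 r2] := reducible_all t (B x); exists r.
have [|c [[x0 cx0] c0]] := @linear_dependence k T {: 'X_{1..m < t + N0}} (fun x u => (r x)@_u).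
  by rewrite card_prod card_ord card_sig.
have cr0 : \sum_x c x *: r x = 0.
  apply/mpolyP => u; rewrite mcoeff0 raddf_sum /=.
  have [lt_u|le_u] := ltnP (mdeg u) (t + N0).
    by rewrite -[RHS](c0 (BMultinom lt_u)); apply: eq_bigr => x _; rewrite mcoeffZ.
  rewrite big1 // => x _; rewrite mcoeffZ memN_msupp_eq0 ?mulr0 //.
  by apply: msize_mdeg_ge; apply: leq_trans (rP x).1 le_u.
have ord z : z \in Z -> worder w t (mshift z (\sum_x c x *: B x)).
  move=> zZ; have -> : \sum_x c x *: B x = \sum_x c x *: (B x - r x).
    by under [RHS]eq_bigr do rewrite scalerBr; rewrite sumrB cr0 subr0.
  rewrite raddf_sum.
  apply: worder_sum => x _ /=; rewrite mshiftZ.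
  exact: worderZ ((rP x).2 z zZ).
pose h := \sum_(a : {a : 'X_{1..m < t} | a \in Q}) c (x0.1, a) *: 'X_[val a] : {mpoly k[m]}.
have oh : worder w t h.
  apply: (@worder_unit _ (mshift (zz x0.1) (E x0.1))).
    by rewrite mshift0 (EP x0.1).1.
  have -> : mshift (zz x0.1) (E x0.1) * h =
     mshift (zz x0.1) (\sum_x c x *: B x) -
     \sum_(x | x.1 != x0.1) c x *: mshift (zz x0.1) (B x).
    rewrite raddf_sum (bigID (fun x : T => x.1 != x0.1)) /=.
    under eq_bigr do rewrite mshiftZ.
    rewrite addrAC subrr add0r mulr_sumr.
    under [RHS]eq_bigr do rewrite mshiftZ.
    rewrite (reindex_onto (fun a => (x0.1, a)) snd) /=; last first.
      by move=> [i a] /=; rewrite negbK => /eqP ->.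
    apply: eq_big => [a|a _]; first by rewrite negbK !eqxx.
    by rewrite /B rmorphM /= cenE scalerAr.
  rewrite -scaleN1r; apply: worderD; first exact: ord.
  rewrite scaler_sumr; apply: worder_sum => x xn.
  rewrite scalerA rmorphM /=; apply: worderZ; rewrite mulrC; apply: worderMl.
  by apply: (EP x.1).2 => //; rewrite (inj_eq zz_inj) eq_sym.
have := oh (val x0.2).
have -> : h@_(val x0.2) = c x0.
  rewrite raddf_sum (bigD1 x0.2) //= mcoeffZ mcoeffX eqxx mulr1.
  rewrite big1 ?addr0 => [|a an]; first by case: (x0).
  rewrite mcoeffZ mcoeffX; case: eqP => [e|]; last by rewrite mulr0.
  by move/eqP: an; case; apply/val_inj/val_inj.
move=> /(_ cx0); apply/negP; rewrite -ltnNge.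
by have := valP x0.2; rewrite inE.
Qed.

Lemma weighted_bezout : (size Z <= \prod_i w i)%N.
Proof.
apply: (@leq_of_shift_growth (fun t => #|{: 'X_{1..m < t}}|) (size Z) _ N0 m).
- by apply/card_gt0P; exists bm0.
- exact: card_bmnm_leq.
- move=> t; apply: leq_trans (leq_mul (leqnn _) (card_bmnm_weighted w_gt0 t)) _.
  by rewrite mulnA mulnC; apply: leq_mul (leqnn _) (weighted_count t).
Qed.

End WeightedBezout.

(** * Linear sections of cones *)

Section ZariskiSets.

Local Open Scope classical_set_scope.

Variables (k : closedFieldType) (n : nat).
Implicit Types (X Y Z : set 'rV[k]_n).

Lemma zariski_closedI X Y :
  zariski_closed X -> zariski_closed Y -> zariski_closed (X `&` Y).
Proof.
move=> [I ->] [J ->]; exists (I `|` J); apply/seteqP; split=> x.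
  by move=> [Ix Jx] f [/Ix|/Jx].
by move=> IJx; split=> f ?; apply: IJx; [left | right].
Qed.

(** Choose u_i vanishing on X (i+1) but not on X i. The chain condition puts some u_N in the ideal
    of the earlier u_i, all of which vanish on X N. *)
Lemma zariski_closed_noetherian (X : nat -> set 'rV[k]_n) :
  (forall i, zariski_closed (X i)) -> (forall i, X i.+1 `<` X i) -> False.
Proof.
move=> cX dX.
have /choice[u uP] : forall i, exists f : {mpoly k[n]},
    (forall x, X i.+1 x -> peval f x = 0) /\ ~ (forall x, X i x -> peval f x = 0).
  move=> i; have [_ nX] := dX i; apply: contrapT => nof; apply: nX => x Xx.
  have [I XI] := cX i.+1; rewrite XI => f If; apply: contrapT => fx.
  apply: nof; exists f; split; last by move/(_ x Xx).
  by move=> y; rewrite XI; apply.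
have [N [c uN]] := @noetherian_mpoly k n u.
have XS i j : (i <= j)%N -> X j `<=` X i.
  elim: j => [|j IHj]; first by rewrite leqn0 => /eqP ->.
  rewrite leq_eqVlt => /predU1P[-> //|/IHj]; apply: subset_trans.
  by case: (dX j).
apply: (uP N).2 => x Xx; rewrite uN /peval raddf_sum big1 // => i _ /=.
have /= := (uP i).1 x (XS i.+1 N (ltn_ord i) x Xx).
by rewrite mevalM /peval => ->; rewrite mulr0.
Qed.

Definition finite_union (N : nat) (W : nat -> set 'rV[k]_n) : set 'rV[k]_n :=
  [set x | exists2 i, (i < N)%N & W i x].

(** Noetherian induction: a counterexample is nonempty and reducible, so one of its two proper
    closed pieces is again a counterexample, and these descend forever. The empty set is the union
    with N = 0. *)
Lemma irreducible_decomposition X : zariski_closed X ->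
  exists N W, (forall i, (i < N)%N -> irreducible_closed (W i)) /\
    X = finite_union N W.
Proof.
move=> cX; apply: contrapT => badX.
pose bad Y := zariski_closed Y /\ ~ exists N W,
  (forall i, (i < N)%N -> irreducible_closed (W i)) /\ Y = finite_union N W.
have /choice[next nextP] : forall Y, exists Y', bad Y -> bad Y' /\ Y' `<` Y.
  move=> Y; have [bY|] := pselect (bad Y); last by exists Y.
  apply: contrapT => noY; case: (bY) => cY; apply.
  have dec A : zariski_closed A -> ~ (Y `<=` A) -> exists N W,
      (forall i, (i < N)%N -> irreducible_closed (W i)) /\
      Y `&` A = finite_union N W.
    move=> cA nYA; apply: contrapT => nA; apply: noY; exists (Y `&` A) => _.
    split; first by split=> //; apply: zariski_closedI.
    split; first by move=> x [].
    by move=> YA; apply: nYA => x /YA[].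
  have [Y0|Y0] := pselect (Y !=set0); last first.
    exists 0%N, (fun=> set0); split=> //; apply/seteqP; split=> x; last by case.
    by move=> Yx; case: Y0; exists x.
  have [irr|nirr] := pselect (irreducible_closed Y).
    exists 1%N, (fun=> Y); split=> //; apply/seteqP; split=> x; last by case.
    by exists 0%N.
  have [A [B [cA cB YAB [nA nB]]]] : exists A B, [/\ zariski_closed A,
      zariski_closed B, Y `<=` A `|` B & ~ (Y `<=` A) /\ ~ (Y `<=` B)].
    apply: contrapT => noAB; apply: nirr; split=> // A B cA cB YAB.
    apply: contrapT => nYAB; apply: noAB; exists A, B; split=> //.
    by split=> ?; apply: nYAB; [left | right].
  have [N1 [W1 [irr1 E1]]] := dec _ cA nA.
  have [N2 [W2 [irr2 E2]]] := dec _ cB nB.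
  exists (N1 + N2)%N, (fun i => if (i < N1)%N then W1 i else W2 (i - N1)%N).
  split=> [i lt_i|].
    by case: ltnP => [/irr1 //|le_i]; apply: irr2; rewrite ltn_subLR.
  have -> : Y = (Y `&` A) `|` (Y `&` B).
    by rewrite -setIUr; apply/esym/setIidPl.
  rewrite E1 E2; apply/seteqP; split=> x.
    move=> [[i lt_i Wx]|[i lt_i Wx]].
      by exists i; rewrite ?lt_i //; apply: ltn_addr.
    by exists (N1 + i)%N; rewrite ?ltn_add2l // ltnNge leq_addr /= addKn.
  move=> [i lt_i +]; case: ltnP => [lt1 Wx|le1 Wx]; first by left; exists i.
  by right; exists (i - N1)%N => //; rewrite ltn_subLR.
pose Xs i := iter i next X.
have bXs i : bad (Xs i).
  by elim: i => // i IHi; rewrite /Xs iterS; case: (nextP _ IHi).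
apply: (@zariski_closed_noetherian Xs) => i; first by case: (bXs i).
by rewrite /Xs iterS; case: (nextP _ (bXs i)).
Qed.

Lemma irreducible_in_union Z N W : irreducible_closed Z ->
  (forall i, (i < N)%N -> zariski_closed (W i)) ->
  Z `<=` finite_union N W -> exists2 i, (i < N)%N & Z `<=` W i.
Proof.
have cU M : (forall i, (i < M)%N -> zariski_closed (W i)) ->
    zariski_closed (finite_union M W).
  elim: M => [|M IHM] cW.
    exists [set 1]; apply/seteqP; split=> x; first by case.
    by move=> /(_ 1 erefl); rewrite /peval meval1 => /eqP; rewrite oner_eq0.
  have [I EI] := IHM (fun i lt_i => cW i (ltnW lt_i)).
  have [J EJ] := cW M (ltnSn M).
  exists [set h | exists f g, [/\ I f, J g & h = f * g]].
  apply/seteqP; split=> x.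
    move=> [i + +]; rewrite ltnS leq_eqVlt => /predU1P[-> Wx|lt_i Wx] h [f [g [If Jg ->]]].
      rewrite /peval mevalM; have : W M x by []. 
      by rewrite EJ => /(_ _ Jg); rewrite /peval => ->; rewrite mulr0.
    have : finite_union M W x by exists i.
    by rewrite EI => /(_ _ If); rewrite /peval mevalM => ->; rewrite mul0r.
  move=> hx; have [Wx|nWx] := pselect (W M x); first by exists M.
  suff : finite_union M W x by move=> [i lt_i Wx]; exists i => //; apply: ltnW.
  rewrite EI => f If; apply: contrapT => fx; apply: nWx; rewrite EJ => g Jg.
  have /hx : exists f' g', [/\ I f', J g' & f * g = f' * g'] by exists f, g.
  by rewrite /peval mevalM => /eqP; rewrite mulf_eq0 => /orP[/eqP|/eqP].
move=> irrZ; elim: N => [|N IHN] cW ZW.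
  by case: irrZ => _ [x Zx]; have [] := ZW _ Zx.
have cW' i : (i < N)%N -> zariski_closed (W i) by move=> lt_i; apply: cW; apply: ltnW.
case: (irrZ) => _ _ /(_ (finite_union N W) (W N) (cU N cW') (cW N (ltnSn N))).
case=> [x /ZW[i + +]|/(IHN cW')[i lt_i ZWi]|ZWN].
- rewrite ltnS leq_eqVlt => /predU1P[-> Wx|lt_i Wx]; [by right | left].
  by exists i.
- by exists i => //; apply: ltnW.
- by exists N.
Qed.

Lemma zariski_closed_linear (p : nat) (L : 'M[k]_(n, p)) :
  zariski_closed [set x | x *m L = 0].
Proof.
exists [set f | exists j, f = \sum_i L i j *: 'X_i].
have ev x j : peval (\sum_i L i j *: 'X_i) x = (x *m L) 0 j.
  rewrite /peval raddf_sum mxE; apply: eq_bigr => i _ /=.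
  by rewrite mevalZ mevalXU mulrC.
apply/seteqP; split=> x /=.
  by move=> xL f [j ->]; rewrite ev xL mxE.
by move=> h; apply/rowP => j; rewrite -ev mxE; apply: h; exists j.
Qed.

Lemma irreducible_line (x : 'rV[k]_n) :
  irreducible_closed [set y | exists c : k, y = c *: x].
Proof.
split.
- have [-> | x0] := eqVneq x 0.
    have := zariski_closed_linear (1%:M : 'M_n); congr zariski_closed.
    apply/seteqP; split=> y /=; first by rewrite mulmx1 => ->; exists 0; rewrite scale0r.
    by move=> [c ->]; rewrite scaler0 mul0mx.
  have [j xj] := rV0Pn _ x0.
  (* The entries of [y *m L] are the 2 by 2 minors y_b x_j - y_j x_b; as x_j is nonzero, their
     vanishing defines the line through [x]. *)
  pose L : 'M[k]_n := \matrix_(a, b) (x 0 j *+ (a == b) - x 0 b *+ (a == j)).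
  have := zariski_closed_linear L; congr zariski_closed.
  have yL (y : 'rV[k]_n) b : (y *m L) 0 b = y 0 b * x 0 j - y 0 j * x 0 b.
    rewrite mxE; under eq_bigr do rewrite mxE mulrBr.
    rewrite sumrB (bigD1 b) //= eqxx mulr1n big1 ?addr0; last first.
      by move=> i /negPf ->; rewrite mulr0n mulr0.
    rewrite (bigD1 j) //= eqxx mulr1n big1 ?addr0 // => i /negPf ->.
    by rewrite mulr0n mulr0.
  apply/seteqP; split=> y /=.
    move=> yL0; exists (y 0 j / x 0 j); apply/rowP => b; rewrite mxE.
    have := yL y b; rewrite yL0 mxE => /esym/eqP; rewrite subr_eq0 => /eqP E.
    by rewrite mulrAC -E mulfK.
  by move=> [c ->]; apply/rowP => b; rewrite yL !mxE; ring.
- by exists 0; exists 0; rewrite scale0r.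
- move=> A B [I ->] [J ->] lAB; apply: contrapT => nAB.
  have [nA nB] : ~ ([set y | exists c : k, y = c *: x] `<=` zero_locus I) /\
                 ~ ([set y | exists c : k, y = c *: x] `<=` zero_locus J).
    by split=> ?; apply: nAB; [left | right].
  have get (K : set {mpoly k[n]}) :
      ~ ([set y | exists c : k, y = c *: x] `<=` zero_locus K) ->
      exists2 f, K f & exists c, peval f (c *: x) != 0.
    move=> nK; apply: contrapT => nof; apply: nK => y [c ->] f Kf.
    by apply: contrapT => /eqP fc; apply: nof; exists f => //; exists c.
  have [f If [c fc]] := get _ nA; have [g Jg [d gd]] := get _ nB.
  (* Restriction to the line is a univariate polynomial; a nonroot of the product of two nonzero
     restrictions is a point of the line outside both closed sets. *)
  pose T (h : {mpoly k[n]}) : {poly k} := mmap polyC (fun i => x 0 i *: 'X) h.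
  have TE h t : (T h).[t] = peval h (t *: x).
    rewrite /T /peval mevalE /mmap horner_sum; apply: eq_bigr => m _.
    rewrite hornerM hornerC horner_prod; congr (_ * _); apply: eq_bigr => i _.
    by rewrite horner_exp hornerZ hornerX mxE mulrC.
  have Tn0 h t : peval h (t *: x) != 0 -> T h != 0.
    by rewrite -TE; apply: contraNneq => ->; rewrite horner0.
  have : T f * T g != 0 by rewrite mulf_neq0 // (Tn0 _ _ fc, Tn0 _ _ gd).
  move=> /closed_nonrootP[t]; rewrite rootM negb_or !rootE !TE => /andP[ft gt].
  have [] := lAB (t *: x) (ex_intro _ t erefl).
    by move=> /(_ _ If) f0; rewrite f0 eqxx in ft.
  by move=> /(_ _ Jg) g0; rewrite g0 eqxx in gt.
Qed.

(** Search along the moment curve l_i = t^i: [v *m l] is then the value at t of the polynomial with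
    coefficients [v], so only finitely many t are excluded. *)
Lemma avoid_hyperplane (s : seq 'rV[k]_n) :
  exists l : 'cV[k]_n, forall v, v \in s -> v != 0 -> v *m l != 0.
Proof.
pose Q := \prod_(v <- s | v != 0) rVpoly v.
have : Q != 0.
  rewrite /Q; apply: (big_ind (fun p : {poly k} => p != 0)) => [|p q|v v0]; rewrite ?oner_neq0 //.
    exact: mulf_neq0.
  by apply: contraNneq v0 => v0; rewrite -[v]rVpolyK v0 linear0.
move=> /closed_nonrootP[t]; rewrite rootE /Q horner_prod prodf_seq_neq0.
move=> /allP Qt; exists (\col_i t ^+ i) => v vs v0.
have := implyP (Qt v vs) v0; apply: contraNneq => vl.
have <- : (v *m \col_i t ^+ i) 0 0 = (rVpoly v).[t] by
  rewrite mxE horner_poly; apply: eq_bigr => i _; rewrite mxE valK.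
by rewrite vl mxE.
Qed.

(* Each step cuts with a hyperplane through the origin containing no
   component other than {0}, so the longest chain becomes shorter. *)
Lemma cone_linear_section (D : nat) X :
  zariski_closed X -> (forall c x, X x -> X (c *: x)) ->
  (forall N, has_chain X N -> (N <= D)%N) ->
  exists L : 'M[k]_(n, D), forall x, X x -> x *m L = 0 -> x = 0.
Proof.
elim: D X => [|D IHD] X cX coneX dimX.
  (* A nonzero point x of the cone would give the chain {0}, line through x, of length 1. *)
  exists 0 => x Xx _; apply/eqP/negPn/negP => x0.
  suff /dimX : has_chain X 1 by [].
  exists (fun i => if i is 0%N then [set y | exists c : k, y = c *: (0 : 'rV[k]_n)]
                 else [set y | exists c : k, y = c *: x]); split=> [i _|i].
    split; first by case: i => [|i]; apply: irreducible_line.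
    case: i => [|i] y /= [c ->]; last exact: coneX.
    by rewrite scaler0 -(scale0r x); apply: coneX.
  rewrite ltnS leqn0 => /eqP -> /=; split.
    by move=> y [c ->]; exists 0; rewrite scaler0 scale0r.
  move=> /(_ x (ex_intro _ 1 (esym (scale1r x)))) [c xc].
  by move: x0; rewrite xc scaler0 eqxx.
have [N [W [irrW XW]]] := irreducible_decomposition cX.
have /choice[p pP] : forall i, exists p : 'rV[k]_n,
    (exists2 y, W i y & y != 0) -> W i p /\ p != 0.
  move=> i; have [[y Wy y0]|nW] := pselect (exists2 y, W i y & y != 0).
    by exists y.
  by exists 0 => /nW.
have [l lP] := avoid_hyperplane (mkseq p N).
pose X' := X `&` [set x | x *m l = 0].
have [|c x [Xx xl]|M [Z [irrZ dZ]]|L LP] := IHD X'.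
- by apply: zariski_closedI => //; apply: zariski_closed_linear.
- by split; [apply: coneX | rewrite /= -scalemxAl xl scaler0].
- have [irrM ZM] := irrZ M (leqnn M).
  have [||i lt_i ZW] := irreducible_in_union irrM (N := N) (W := W).
  + by move=> i /irrW[].
  + by rewrite -XW => x /ZM[].
  (* If the component containing the top of the chain is {0}, the chain has length 0 and the bound
     is trivial. *)
  have [Wp|nWp] := pselect (exists2 y, W i y & y != 0); last first.
    case: M irrZ dZ irrM ZM ZW => // M irrZ dZ irrM ZM ZW.
    have Z0 x : Z M.+1 x -> x = 0.
      move=> /ZW Wx; apply/eqP/negPn/negP => x0; apply: nWp; by exists x.
    have [sM []] := dZ M (ltnSn M).
    have [[_ [y Zy] _] _] := irrZ M (leqnSn M).
    by move=> x /Z0 ->; rewrite -(Z0 y (sM _ Zy)).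
  have [Wpi pi0] := pP i Wp.
  suff /dimX : has_chain X M.+1 by [].
  (* Adding the whole component on top lengthens the chain: the inclusion is strict because [p i]
     lies in [W i] and off the hyperplane. *)
  exists (fun j => if (j <= M)%N then Z j else W i); split=> j.
    move=> _; case: leqP => [/irrZ[irrj ZX]|_].
      by split=> // x /ZX[].
    split; first exact: irrW.
    by move=> x Wx; rewrite XW; exists i.
  rewrite ltnS => le_jM; rewrite le_jM; have [lt_jM|le_Mj] := ltnP j M.
    exact: dZ.
  have -> : j = M by apply/eqP; rewrite eqn_leq le_jM.
  split=> // WZ; have [_ /= /eqP] := ZM _ (WZ _ Wpi).
  by apply/negP; apply: lP => //; apply: map_f; rewrite mem_iota.
- exists (row_mx l L) => x Xx.
  move=> /(eq_trans (esym (mul_mx_row x l L)))/eqP.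
  rewrite row_mx_eq0 => /andP[/eqP xl /eqP xL].
  exact: LP.
Qed.

End ZariskiSets.

(** * Gowers norms and characters *)

Lemma big_tuple_cons (A : nmodType) (T : finType) (l : nat) (F : seq T -> A) :
  \sum_(t : l.+1.-tuple T) F t = \sum_h \sum_(t : l.-tuple T) F (h :: t).
Proof.
rewrite pair_big /= (reindex (fun x : T * l.-tuple T => [tuple of x.1 :: x.2])) //=.
exists (fun t : l.+1.-tuple T => (thead t, [tuple of behead t])) => [[h t] _|t _] /=.
  by rewrite theadE; congr pair; apply: val_inj.
by rewrite [RHS]tuple_eta.
Qed.

Lemma big_tuple_rcons (A : nmodType) (T : finType) (l : nat) (F : seq T -> A) :
  \sum_(t : l.+1.-tuple T) F t = \sum_(t : l.-tuple T) \sum_h F (rcons t h).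
Proof.
have rev_bij m : bijective (fun t : m.-tuple T => [tuple of rev t]).
  by exists (fun t : m.-tuple T => [tuple of rev t]) => t; apply: val_inj; rewrite /= revK.
rewrite (reindex (fun t : l.+1.-tuple T => [tuple of rev t])) /=; last first.
  by apply: onW_bij; apply: rev_bij.
rewrite (big_tuple_cons _ (fun t => F (rev t))) exchange_big /=.
rewrite (reindex (fun t : l.-tuple T => [tuple of rev t])) /=; last first.
  by apply: onW_bij; apply: rev_bij.
by do 2!apply: eq_bigr => ? _; rewrite rev_cons revK.
Qed.

Section GowersSums.

Variables (R : realType) (G : finZmodType).
Local Notation C := R[i].
Implicit Types (f g : G -> C) (hs : seq G).

Definition gowers_sum (l : nat) f : C :=
  \sum_(x : G) \sum_(t : l.-tuple G) mul_derivs t f x.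

Lemma gowers_normE l f :
  gowers_norm l f = complex.Re (gowers_sum l f / (#|G| ^ l.+1)%:R) `^ (2 ^+ l)^-1.
Proof.
rewrite /gowers_norm /average card_prod card_tuple expnS /gowers_sum.
by rewrite pair_big.
Qed.

Lemma gowers_sumS l f :
  gowers_sum l.+1 f = \sum_h gowers_sum l (mul_deriv h f).
Proof.
rewrite /gowers_sum exchange_big /=; under [RHS]eq_bigr do rewrite exchange_big /=.
exact: (big_tuple_cons _ (fun t => \sum_x mul_derivs t f x)).
Qed.

Lemma mul_derivs_ext hs f g : f =1 g -> mul_derivs hs f =1 mul_derivs hs g.
Proof. by move=> /funext ->. Qed.

Lemma mul_derivs_cross hs f g h x :
  mul_derivs hs (fun y => f (y + h) * (g y)^*) x =
  mul_derivs hs f (x + h) * (mul_derivs hs g x)^*.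
Proof.
elim: hs f g x => // h' hs IHhs f g x; rewrite /mul_derivs /=.
rewrite -[RHS]IHhs; apply: mul_derivs_ext => y.
by rewrite /mul_deriv addrAC !rmorphM /= !conjCK mulrACA.
Qed.

(** Summing over the shift decouples f from g, since x + h and x range independently. For f = g this
    is a sum of squares; in general it reduces cross terms to products of two complex numbers. *)
Lemma gowers_sum_cross l f g :
  \sum_h gowers_sum l (fun y => f (y + h) * (g y)^*) =
  \sum_(t : l.-tuple G) (\sum_x mul_derivs t f x) * (\sum_x mul_derivs t g x)^*.
Proof.
rewrite /gowers_sum; under eq_bigr do rewrite exchange_big /=.
rewrite exchange_big /=; apply: eq_bigr => t _; rewrite exchange_big /=.
rewrite rmorph_sum mulr_sumr; apply: eq_bigr => x _.
under eq_bigr do rewrite mul_derivs_cross.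
rewrite -mulr_suml; congr (_ * _).
by rewrite [RHS](reindex_inj (addrI x)).
Qed.

Lemma gowers_sum_sqr l f :
  gowers_sum l.+1 f = \sum_(t : l.-tuple G) `|\sum_x mul_derivs t f x| ^+ 2.
Proof.
rewrite gowers_sumS gowers_sum_cross; apply: eq_bigr => t _.
by rewrite normCK.
Qed.

Lemma gowers_sum_scale l (c : C) f : c^* = c ->
  gowers_sum l (fun x => c * f x) = c ^+ (2 ^ l) * gowers_sum l f.
Proof.
move=> cR; rewrite /gowers_sum mulr_sumr; apply: eq_bigr => x _.
rewrite mulr_sumr; apply: eq_bigr => -[t /= /eqP <-] _.
elim: t c f cR => [|h t IHt] c f cR; first by rewrite expr1.
rewrite /= expnS exprM -[RHS]IHt ?rmorphXn /= ?cR //; apply: mul_derivs_ext => y.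
by rewrite /mul_deriv rmorphM /= cR expr2 mulrACA.
Qed.

Lemma ReD (z1 z2 : C) : complex.Re (z1 + z2) = complex.Re z1 + complex.Re z2.
Proof. by case: z1 z2 => [? ?] [? ?]. Qed.

Lemma Re_sum (I : Type) (s : seq I) (F : I -> C) :
  complex.Re (\sum_(i <- s) F i) = \sum_(i <- s) complex.Re (F i).
Proof. exact: (big_morph _ ReD). Qed.

Lemma Re_cross_leq (z1 z2 : C) :
  complex.Re (z1 * z2^*) *+ 2 <= complex.Re (z1 * z1^*) + complex.Re (z2 * z2^*).
Proof.
rewrite -subr_ge0; case: z1 z2 => [a b] [c d] /=.
rewrite (_ : _ - _ = (a - c) ^+ 2 + (b - d) ^+ 2); last by ring.
by rewrite addr_ge0 // sqr_ge0.
Qed.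

Lemma gowers_sum0 f : gowers_sum 0 f = \sum_x f x.
Proof.
apply: eq_bigr => x _; rewrite (eq_bigr (fun=> f x)) => [|t _].
  by rewrite sumr_const card_tuple expn0 mulr1n.
by rewrite tuple0.
Qed.

(** Induction on [l], bypassing the Gowers-Cauchy-Schwarz inequality. One derivative turns the sum
    over T into a sum over T x T of f_a(x + h) times the conjugate of f_b(x). After the induction
    hypothesis and summation over h, each cross term is at most the mean of the terms for a and b,
    so the double sum is at most |T| times the single one; the exponents match because |T|^(2^(l+1)
    - 1) = |T| (|T|^2)^(2^l - 1). *)
Lemma gowers_sum_convex l (T : finType) (f : T -> G -> C) : (0 < #|T|)%N ->
  complex.Re (gowers_sum l (fun x => \sum_a f a x)) <=
  (\sum_a complex.Re (gowers_sum l (f a))) *+ (#|T| ^ (2 ^ l - 1)).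
Proof.
elim: l T f => [|l IHl] T f T0.
  rewrite expn0 subnn expn0 mulr1n -Re_sum gowers_sum0 exchange_big /=.
  by under [X in _ <= complex.Re X]eq_bigr do rewrite gowers_sum0.
rewrite gowers_sumS Re_sum.
pose f2 h (ab : T * T) x := f ab.1 (x + h) * (f ab.2 x)^*.
have E h : mul_deriv h (fun x => \sum_a f a x) =1 fun x => \sum_ab f2 h ab x.
  move=> x; rewrite /mul_deriv rmorph_sum mulr_suml.
  under eq_bigr do rewrite mulr_sumr.
  by rewrite pair_big.
have Eh h : gowers_sum l (mul_deriv h (fun x => \sum_a f a x)) =
   gowers_sum l (fun x => \sum_ab f2 h ab x) by rewrite (funext (E h)).
under eq_bigr do rewrite Eh.
apply: le_trans (_ : \sum_h (\sum_ab complex.Re (gowers_sum l (f2 h ab))) *+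
    (#|{: T * T}| ^ (2 ^ l - 1)) <= _).
  by apply: ler_sum => h _; apply: IHl; rewrite card_prod muln_gt0 T0.
rewrite sumrMnl exchange_big /=.
have -> : (#|T| ^ (2 ^ l.+1 - 1) = #|T| * #|{: T * T}| ^ (2 ^ l - 1))%N.
  have l0 : (0 < 2 ^ l)%N by rewrite expn_gt0.
  rewrite card_prod mulnn -expnM -expnS expnS.
  by congr (_ ^ _)%N; lia.
rewrite mulrnA ler_wMn2r // -(ler_pMn2r (isT : 0 < 2)%N).
have cross ab : (\sum_h complex.Re (gowers_sum l (f2 h ab))) *+ 2 <=
    complex.Re (gowers_sum l.+1 (f ab.1)) + complex.Re (gowers_sum l.+1 (f ab.2)).
  rewrite -Re_sum gowers_sum_cross !gowers_sum_sqr !Re_sum -big_split -sumrMnl.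
  by apply: ler_sum => t _; rewrite !normCK; apply: Re_cross_leq.
rewrite -sumrMnl; apply: le_trans (ler_sum _ (fun ab _ => cross ab)) _.
rewrite big_split /= -(pair_bigA _ (fun a _ => complex.Re (gowers_sum l.+1 (f a)))).
rewrite -(pair_bigA _ (fun _ b => complex.Re (gowers_sum l.+1 (f b)))) /=.
under eq_bigr do rewrite sumr_const.
by rewrite sumr_const sumrMnl mulr2n.
Qed.

End GowersSums.

(** * Additive characters and phase functions *)

Definition additive_character (R : realType) (p : nat) (chi : 'F_p -> R[i]) :=
  [/\ forall x y, chi (x + y) = chi x * chi y, chi 0 = 1,
      forall x, (chi x)^* = chi (- x) & forall x, x != 0 -> chi x != 1].

(** A root of 1 + X + ... + X^(p-1) is a p-th root of unity other than 1, hence primitive as p is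
    prime; its powers give the character. *)
Lemma additive_character_exists (R : realType) (p : nat) : prime p ->
  exists chi : 'F_p -> R[i], additive_character chi.
Proof.
move=> hp; have p0 := prime_gt0 hp.
pose Q : {poly R[i]} := \poly_(i < p) 1.
have [z] : exists z, root Q z.
  apply/closed_rootP; rewrite size_poly_eq ?oner_neq0 //.
  by rewrite neq_ltn prime_gt1 ?orbT.
rewrite rootE horner_poly; under eq_bigr do rewrite mul1r; move=> Qz.
have zp : z ^+ p = 1.
  apply/eqP; rewrite -subr_eq0 subrX1 mulf_eq0; apply/orP; right.
  exact: Qz.
have z1 : z != 1.
  apply: contraTneq Qz => ->; under eq_bigr do rewrite expr1n.
  by rewrite sumr_const card_ord pnatr_eq0 -lt0n.
have [m zm mp] := prim_order_exists p0 zp.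
have prim : p.-primitive_root z.
  have [_ /(_ m mp)/orP[|]] := primeP hp; last by move/eqP <-.
  by move=> /eqP m1; have := prim_expr_order zm; rewrite m1 expr1 => /eqP; rewrite (negPf z1).
have nz : `|z| = 1.
  apply/eqP; rewrite -(@pexpr_eq1 _ _ p) //.
  by rewrite -normrX zp normr1.
exists (fun x => z ^+ x).
have chiD (x y : 'F_p) : z ^+ (x + y)%R = z ^+ x * z ^+ y.
  rewrite -exprD -(prim_expr_mod prim (x + y)) /=.
  by congr (_ ^+ (_ %% _)%N); rewrite Fp_cast.
split=> //.
- move=> x; have nx : `|z ^+ x| = 1 by rewrite normrX nz expr1n.
  have z0 : z ^+ x != 0 by rewrite -normr_eq0 nx oner_neq0.
  apply: (mulfI z0); rewrite -chiD subrr expr0 -normCK nx expr1n //.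
- move=> x; apply: contra_neq => /eqP; rewrite -(prim_order_dvd prim) => px.
  apply: val_inj => /=; apply/eqP; rewrite -leqn0 leqNgt; apply/negP => x0.
  have := dvdn_leq x0 px; apply/negP; rewrite -ltnNge.
  by apply: leq_trans (ltn_ord x) _; rewrite Fp_cast.
Qed.

Section Phases.

Variables (R : realType) (p : nat) (p_prime : prime p).
Variables (chi : 'F_p -> R[i]) (chiP : additive_character chi).
Variable n : nat.
Local Notation G := 'rV['F_p]_n.

Lemma character_orthogonality (y : G) :
  \sum_(h : G) chi (\sum_j h 0 j * y 0 j) = if y == 0 then #|G|%:R else 0.
Proof.
have [chiD chi0 _ chi1] := chiP.
case: eqP => [->|/eqP y0].
  rewrite (eq_bigr (fun=> 1)) ?sumr_const // => h _.
  by rewrite big1 ?chi0 // => j _; rewrite mxE mulr0.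
have [j yj] := rV0Pn _ y0.
pose h0 : G := (y 0 j)^-1 *: delta_mx 0 j.
have h0E : \sum_i h0 0 i * y 0 i = 1.
  rewrite (bigD1 j) //= !mxE !eqxx mulr1 mulVf // big1 ?addr0 // => i /negPf ij.
  by rewrite !mxE ij andbF mulr0 mul0r.
have c1 : chi 1 != 1 by apply: chi1; apply: oner_neq0.
set s := \sum_h _; have : chi 1 * s = s.
  rewrite mulr_sumr [RHS](reindex_inj (addrI h0)) /=; apply: eq_bigr => h _.
  rewrite -chiD -h0E -big_split; congr chi; apply: eq_bigr => i _.
  by rewrite [in RHS]mxE mulrDl.
move=> /eqP; rewrite -subr_eq0 -[X in _ - X]mul1r -mulrBl mulf_eq0 subr_eq0.
by rewrite (negPf c1) => /eqP.
Qed.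

Definition add_derivs (hs : seq G) (q : G -> 'F_p) : G -> 'F_p :=
  foldl (fun g h x => g (x + h) - g x) q hs.

Lemma mul_derivs_phase hs (q : G -> 'F_p) :
  mul_derivs hs (chi \o q) =1 chi \o add_derivs hs q.
Proof.
have [chiD _ chiN _] := chiP.
elim: hs q => // h hs IHhs q x; rewrite /mul_derivs /= -[RHS]IHhs.
by apply: mul_derivs_ext => y; rewrite /mul_deriv /= chiN -chiD.
Qed.

(** The last direction h enters linearly with a coefficient free of x, so orthogonality in h detects
    [L t = 0]. One factor #|G| comes from h and one from x. *)
Lemma gowers_sum_phase e (q : G -> 'F_p) (L : seq G -> G) :
  (forall (t : e.-tuple G) x h,
     add_derivs t q (x + h) - add_derivs t q x = \sum_j h 0 j * L t 0 j) ->
  gowers_sum e.+1 (chi \o q) =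
  (#|G| ^ 2 * #|[set t : e.-tuple G | L t == 0]|)%:R.
Proof.
move=> qL; have -> : gowers_sum e.+1 (chi \o q) =
    \sum_(x : G) (#|G| * #|[set t : e.-tuple G | L t == 0]|)%:R.
  apply: eq_bigr => x _; rewrite (big_tuple_rcons _ (fun t => mul_derivs t (chi \o q) x)).
  have Et t : \sum_h mul_derivs (rcons t h) (chi \o q) x =
      \sum_h chi (add_derivs t q (x + h) - add_derivs t q x).
    apply: eq_bigr => h _; rewrite mul_derivs_phase /= /add_derivs.
    by rewrite -cats1 foldl_cat.
  under eq_bigr => t _ do [rewrite Et; under eq_bigr do rewrite qL;
    rewrite character_orthogonality].
  rewrite -big_mkcond sumr_const natrM mulr_natr; congr (_ *+ _).
  by apply: eq_card => t; rewrite inE.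
by rewrite sumr_const -mulrnA mulnAC mulnn.
Qed.

End Phases.

(** * Polarization *)

Section Polarization.

Variables (F : fieldType) (n : nat).
Implicit Types (f g : {mpoly F[n]}) (hs : seq 'rV[F]_n).

(* Iterated directional derivative along [hs], evaluated at 0; for a form of
   degree [size hs] this is its full polarization. *)
Fixpoint polar hs f : F :=
  if hs is h :: hs' then \sum_i h 0 i * polar hs' f^`M(i) else f@_0.

Lemma polarP hs c f g : polar hs (c *: f + g) = c * polar hs f + polar hs g.
Proof.
elim: hs f g => [|h hs IHhs] f g /=; first by rewrite mcoeffD mcoeffZ.
rewrite mulr_sumr -big_split; apply: eq_bigr => i _.
by rewrite mderivD mderivZ IHhs mulrDr mulrCA.
Qed.

Lemma polar0 hs : polar hs 0 = 0.
Proof.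
elim: hs => [|h hs IHhs] /=; first exact: mcoeff0.
by rewrite big1 // => i _; rewrite mderiv0 IHhs mulr0.
Qed.

Lemma polarD hs f g : polar hs (f + g) = polar hs f + polar hs g.
Proof. by rewrite -[f]scale1r polarP mul1r scale1r. Qed.

Lemma polarZ hs c f : polar hs (c *: f) = c * polar hs f.
Proof. by rewrite -[c *: f]addr0 polarP polar0 addr0. Qed.

Lemma polar_sum hs (I : Type) (s : seq I) (K : I -> {mpoly F[n]}) :
  polar hs (\sum_(i <- s) K i) = \sum_(i <- s) polar hs (K i).
Proof. exact: (big_morph _ (polarD hs) (polar0 hs)). Qed.

Lemma msize_mderiv f i : (msize f^`M(i) <= (msize f).-1)%N.
Proof.
apply/msize_leqP => m; rewrite mcoeff_deriv => h.
have : f@_(m + U_(i)) != 0 by apply: contraNneq h => ->; rewrite mul0rn.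
rewrite -mcoeff_msupp => /msize_mdeg_lt; rewrite mdegD mdeg1 addn1.
by case: (msize f).
Qed.

Lemma dhomog_mderiv s f i : f \is s.+1.-homog -> f^`M(i) \is s.-homog.
Proof.
move=> fs; apply/dhomogP => m; rewrite mcoeff_msupp mcoeff_deriv => h /=.
have : f@_(m + U_(i)) != 0 by apply: contraNneq h => ->; rewrite mul0rn.
rewrite -mcoeff_msupp => /(dhomog_mf fs) /=; rewrite mdegD mdeg1 addn1.
by move=> [].
Qed.

Lemma polar_small hs f : (msize f <= size hs)%N -> polar hs f = 0.
Proof.
elim: hs f => [|h hs IHhs] f /= fs.
  by move: fs; rewrite leqn0 msize_poly_eq0 => /eqP ->; rewrite mcoeff0.
rewrite big1 // => i _; rewrite IHhs ?mulr0 //.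
by apply: leq_trans (msize_mderiv f i) _; case: (msize f) fs.
Qed.

Lemma mderiv_sumE f i :
  f^`M(i) = \sum_(m <- msupp f) f@_m *: ('X_[m] : {mpoly F[n]})^`M(i).
Proof.
by rewrite {1}(mpolyE f) linear_sum; apply: eq_bigr => m _; rewrite linearZ.
Qed.

Lemma euler_identity s f (x : 'rV[F]_n) : f \is s.-homog ->
  \sum_i x 0 i * peval f^`M(i) x = s%:R * peval f x.
Proof.
move=> fs.
rewrite /peval {2}(mpolyE f) raddf_sum mulr_sumr /=.
under eq_bigr do rewrite mderiv_sumE raddf_sum mulr_sumr /=.
rewrite exchange_big big_seq [RHS]big_seq /=.
apply: eq_bigr => m /(dhomog_mf fs) /= ms.
under eq_bigr do rewrite mevalZ mderivX mevalZ.
rewrite mevalZ mulrCA -ms mdegE natr_sum mulr_suml mulr_sumr; apply: eq_bigr => i _.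
rewrite [x 0 i * _]mulrCA; congr (_ * _); rewrite mulrCA.
have [->|mi] := eqVneq (m i) 0%N; first by rewrite !mul0r.
congr (_ * _); rewrite -(mevalXU (fun j => x 0 j) i) -mevalM -mpolyXD addmC submK //.
by rewrite lep1mP.
Qed.

(** Iterated Euler identity: each derivative contributes the current degree, which builds up s!. *)
Lemma polar_diag s f (x : 'rV[F]_n) : f \is s.-homog ->
  polar (nseq s x) f = (s`!)%:R * peval f x.
Proof.
elim: s f => [|s IHs] f fs /=.
  rewrite fact0 mul1r; have := dhomog_msize_leq fs.
  by move=> /msize1_polyC ->; rewrite /peval mevalC mcoeffC eqxx mulr1.
under eq_bigr => i _ do rewrite (IHs _ (dhomog_mderiv i fs)) mulrCA.
by rewrite -mulr_sumr (euler_identity _ fs) mulrA -natrM mulnC -factS.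
Qed.

(** The Taylor remainder beyond first order in [h]; it lies two degrees below f, which is what makes
    differences agree with derivatives at top degree. *)
Definition linear_remainder (h : 'rV[F]_n) f :=
  mshift h f - f - \sum_i h 0 i *: f^`M(i).

Lemma msize_linear_remainderX h m :
  (msize (linear_remainder h 'X_[m]) <= (mdeg m).-1)%N.
Proof.
have [s] := ubnP (mdeg m); elim: s m => // s IHs m ms.
have [->|m0] := eqVneq m 0%MM.
  rewrite /linear_remainder mpolyX0 rmorph1 subrr sub0r big1 ?oppr0 ?msize0 //.
  by move=> i _; rewrite -mpolyC1 mderivC scaler0.
have [i mi] : exists i, m i != 0%N.
  apply: contrapT => h0; move/eqP: m0; apply; apply/mnmP => i; rewrite mnm0E.
  by apply/eqP/negPn/negP => mi; apply: h0; exists i.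
pose m' := (m - U_(i))%MM.
have mE : m = (U_(i) + m')%MM by rewrite addmC submK // lep1mP.
have md : mdeg m = (mdeg m').+1 by rewrite mE mdegD mdeg1.
pose dh : {mpoly F[n]} := \sum_j h 0 j *: ('X_[m'] : {mpoly F[n]})^`M(j).
(* Expand (X_i + h_i)(M + dM + R), with M the monomial of m' and R its remainder, and remove X_i M
   and its first-order part h_i M + X_i dM. *)
have -> : linear_remainder h 'X_[m] = 'X_i * linear_remainder h 'X_[m'] +
    (h 0 i)%:MP * (linear_remainder h 'X_[m'] + dh).
  rewrite /linear_remainder -/dh mE mpolyXD rmorphM /= mshiftX.
  have -> : \sum_j h 0 j *: (('X_i : {mpoly F[n]}) * 'X_[m'])^`M(j) =
      (h 0 i)%:MP * 'X_[m'] + 'X_i * dh.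
    under eq_bigr do rewrite mderivM scalerDr.
    rewrite big_split /=; congr (_ + _); last first.
      by rewrite mulr_sumr; apply: eq_bigr => j _; rewrite scalerAr.
    rewrite (bigD1 i) //= big1 ?addr0 => [|j ji].
      rewrite mderivX mnm1E eqxx mul_mpolyC.
      have -> : (U_(i) - U_(i) = 0 :> 'X_{1..n})%MM by apply/mnmP => a; rewrite mnmBE mnm0E subnn.
      by rewrite mpolyX0 scale1r mul1r.
    by rewrite mderivX mnm1E eq_sym (negPf ji) scale0r mul0r scaler0.
  ring.
have IH : (msize (linear_remainder h 'X_[m']) <= (mdeg m').-1)%N by apply: IHs; lia.
have dhs : (msize dh <= mdeg m')%N.
  apply: msize_sum_leq => j _; apply: leq_trans (msizeZ_le _ _) _.
  by apply: leq_trans (msize_mderiv _ _) _; rewrite msizeX.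
rewrite md /=; apply: leq_trans (msizeD_le _ _) _; rewrite geq_max; apply/andP; split.
  have [->|r0] := eqVneq (linear_remainder h 'X_[m']) 0; first by rewrite mulr0 msize0.
  apply: leq_trans (msizeM_bound _ _) _; rewrite msizeX mdeg1.
  have : (0 < msize (linear_remainder h 'X_[m']))%N by rewrite lt0n msize_poly_eq0.
  by move: IH; move: (msize _) (mdeg m') => a b; lia.
rewrite mul_mpolyC; apply: leq_trans (msizeZ_le _ _) _.
apply: leq_trans (msizeD_le _ _) _; rewrite geq_max dhs andbT.
by apply: leq_trans IH _; apply: leq_pred.
Qed.

Lemma msize_linear_remainder h f : (msize (linear_remainder h f) <= (msize f).-2)%N.
Proof.
have -> : linear_remainder h f = \sum_(m <- msupp f) f@_m *: linear_remainder h 'X_[m].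
  rewrite /linear_remainder {1 2}(mpolyE f) raddf_sum /= -sumrB.
  under [X in _ - X]eq_bigr do rewrite mderiv_sumE scaler_sumr.
  rewrite exchange_big -sumrB; apply: eq_bigr => m _ /=.
  rewrite mshiftZ !scalerBr; congr (_ - _); rewrite scaler_sumr.
  by apply: eq_bigr => i _; rewrite !scalerA mulrC.
rewrite big_seq; apply: msize_sum_leq => m /msize_mdeg_lt ms.
apply: leq_trans (msizeZ_le _ _) _.
apply: leq_trans (msize_linear_remainderX _ _) _.
by case: (msize f) ms => // s; rewrite ltnS /=; case: (mdeg m) => // d; case: s.
Qed.

Lemma mshiftE h f :
  mshift h f = f + \sum_i h 0 i *: f^`M(i) + linear_remainder h f.
Proof. rewrite /linear_remainder; ring. Qed.

Lemma peval_mshift h f x : peval (mshift h f) x = peval f (x + h).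
Proof.
rewrite /mshift /peval comp_mpoly_meval; apply: meval_eq => i.
by rewrite tnth_mktuple mevalD mevalXU mevalC mxE.
Qed.

End Polarization.

(** Each difference is a directional derivative plus a remainder two degrees lower, which the
    remaining differentiations kill by [polar_small]. As f has degree at most size hs + 1, an affine
    function is left, whose linear part is the polarized gradient. *)
Lemma add_derivs_polar (p n : nat) (hs : seq 'rV['F_p]_n) (f : {mpoly 'F_p[n]}) x h :
  (msize f <= (size hs).+2)%N ->
  add_derivs hs (peval f) (x + h) - add_derivs hs (peval f) x =
  \sum_j h 0 j * polar hs f^`M(j).
Proof.
elim: hs f => [|h' hs IHhs] f fs; rewrite /add_derivs /=.
  have r0 : linear_remainder h f = 0.
    apply/eqP; rewrite -msize_poly_eq0 -leqn0.
    apply: leq_trans (msize_linear_remainder h f) _.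
    by move: fs => /=; case: (msize f) => [|[|[|]]].
  rewrite -peval_mshift mshiftE r0 addr0 /peval mevalD addrAC subrr add0r.
  rewrite raddf_sum; apply: eq_bigr => i _ /=; rewrite mevalZ; congr (_ * _).
  have : (msize f^`M(i) <= 1)%N.
    by apply: leq_trans (msize_mderiv f i) _; case: (msize f) fs.
  by move=> /msize1_polyC ->; rewrite mevalC mcoeffC eqxx mulr1.
pose g := mshift h' f - f.
have gE : (fun y => peval f (y + h') - peval f y) =1 peval g.
  by move=> y; rewrite -peval_mshift /peval mevalB.
have rs := msize_linear_remainder h' f.
have gS : g = \sum_i h' 0 i *: f^`M(i) + linear_remainder h' f.
  by rewrite /g mshiftE; ring.
have gs : (msize g <= (size hs).+2)%N.
  rewrite gS; apply: leq_trans (msizeD_le _ _) _; rewrite geq_max; apply/andP; split.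
    apply: msize_sum_leq => i _; apply: leq_trans (msizeZ_le _ _) _.
    by apply: leq_trans (msize_mderiv f i) _; case: (msize f) fs.
  by apply: leq_trans rs _; move: fs => /=; move: (msize f) (size hs) => a b; lia.
have := IHhs g gs; rewrite /add_derivs (funext gE) => ->; apply: eq_bigr => j _.
congr (_ * _); rewrite gS mderivD polarD raddf_sum polar_sum /= [X in _ + X]polar_small.
  by rewrite addr0; apply: eq_bigr => i _; rewrite linearZ /= polarZ mderiv_comm.
apply: leq_trans (msize_mderiv _ _) _.
by move: rs fs => /=; move: (msize _) (msize f) (size hs) => a b c; lia.
Qed.

(** * Points over the prime field *)

Lemma prod_nat_if_ltn (a b c m : nat) : (c <= m)%N ->
  (\prod_(i < m) (if i < c then a else b) = a ^ c * b ^ (m - c))%N.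
Proof.
move=> le_cm; rewrite -(big_mkord xpredT (fun i => if (i < c)%N then a else b)).
rewrite (big_cat_nat (n := c)) //=; congr muln.
  rewrite (eq_big_nat _ _ (F2 := fun=> a)) ?prod_nat_const_nat ?subn0 //.
  by move=> i /andP[_ ->].
rewrite (eq_big_nat _ _ (F2 := fun=> b)) ?prod_nat_const_nat //.
by move=> i /andP[le_ci _]; rewrite ltnNge le_ci.
Qed.

Lemma dhomog_comp_linear (k : fieldType) (m N s : nat) (f : {mpoly k[m]})
    (l : 'I_m -> {mpoly k[N]}) :
  f \is s.-homog -> (forall i, l i \is 1.-homog) ->
  f \mPo [tuple l i | i < m] \is s.-homog.
Proof.
move=> fs l1; rewrite comp_mpolyE big_seq; apply: rpred_sum => a /(dhomog_mf fs) /= as_.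
apply: rpredZ; rewrite -as_ mdegE.
apply: (big_ind2 (fun (q : {mpoly k[N]}) t => q \is t.-homog)).
- exact: dhomog1.
- by move=> q1 t1 q2 t2; apply: dhomogM.
- by move=> i _; rewrite tnth_mktuple; have := dhomogMn (a i) (l1 i); rewrite mul1n.
Qed.

Lemma mshift_linear (k : fieldType) (m : nat) (z : 'rV[k]_m) (l : {mpoly k[m]}) :
  l \is 1.-homog -> mshift z l = l + (peval l z)%:MP.
Proof.
move=> l1; rewrite (mpolyE l) big_seq.
apply: (big_ind (fun q => mshift z q = q + (peval q z)%:MP)).
- by rewrite rmorph0 /peval meval0 mpolyC0 addr0.
- by move=> q1 q2 E1 E2; rewrite rmorphD /= E1 E2 /peval mevalD mpolyCD addrACA.
- move=> a /(dhomog_mf l1) /= /eqP/mdeg1P[i /eqP ->].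
  rewrite mshiftZ mshiftX scalerDr /peval mevalZ mevalXU mpolyCM.
  by rewrite mul_mpolyC.
Qed.

(* Adjoin to the forms [g] the polynomials with leading forms the [p]-th powers
   of the given linear forms and derivative -1: in the Frobenius-twisted
   coordinates they are [(x L)_j ^ p - X_j], and vanish at points of [F_p ^ m]. *)
Lemma frobenius_fixed_points_bound (k : closedFieldType) (p : nat)
    (charp : p \in [pchar k]) (m c e : nat) (J : finType)
    (g : J -> {mpoly k[m]}) (L : 'M[k]_m) (Z : seq 'rV[k]_m) :
  (c <= m)%N -> (0 < e <= p)%N -> (forall j, g j \is e.-homog) ->
  L \in unitmx ->
  (forall x, (forall j, peval (g j) x = 0) ->
     (forall i : 'I_m, (i < c)%N -> (x *m L) 0 i = 0) -> x = 0) ->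
  uniq Z ->
  (forall z, z \in Z -> (forall i, z 0 i ^+ p = z 0 i) /\
     forall j, peval (g j) z = 0) ->
  (size Z <= p ^ c * e ^ (m - c))%N.
Proof.
move=> le_cm /andP[e0 le_ep] ghom Lu gL uZ ZP.
have p_prime := pcharf_prime charp; have p1 := prime_gt1 p_prime.
pose phi : {rmorphism k -> k} := pFrobenius_aut charp.
have phiE x : phi x = x ^+ p by rewrite /phi /= pFrobenius_autE.
(* In the coordinates y = x Lp, a point x fixed by Frobenius satisfies (x L)_j^p = y_j. The linear
   term of each adjoined equation is thus a single variable, which can be given weight p. *)
pose Lp := map_mx phi L; pose A := invmx Lp.
have Lpu : Lp \in unitmx by rewrite map_unitmx.
pose lin a : {mpoly k[m]} := \sum_b A b a *: 'X_b.
have linE a y : peval (lin a) y = (y *m A) 0 a.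
  rewrite /peval raddf_sum mxE; apply: eq_bigr => b _ /=.
  by rewrite mevalZ mevalXU mulrC.
have lin1 a : lin a \is 1.-homog.
  by apply: rpred_sum => b _; apply: rpredZ; rewrite dhomogX /= mdeg1.
pose sub (f : {mpoly k[m]}) := f \mPo [tuple lin i | i < m].
have subE f y : peval (sub f) y = peval f (y *m A).
  rewrite /sub /peval comp_mpoly_meval; apply: meval_eq => a.
  by rewrite tnth_mktuple -linE.
pose wd := widen_ord le_cm.
pose Y j : {mpoly k[m]} := \sum_a L a (wd j) *: lin a.
have YE j y : peval (Y j) y = (y *m A *m L) 0 (wd j).
  rewrite /peval raddf_sum mxE; apply: eq_bigr => a _ /=.
  by rewrite mevalZ -[_.@[_]]/(peval (lin a) y) linE mulrC.
have Y1 j : Y j \is 1.-homog by apply: rpred_sum => a _; apply: rpredZ.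
pose F (u : J + 'I_c) := match u with inl j => sub (g j) | inr j => Y j ^+ p end.
pose f (u : J + 'I_c) :=
  match u with inl j => sub (g j) | inr j => Y j ^+ p - 'X_(wd j) end.
pose om (u : J + 'I_c) := if u is inl _ then e else p.
have Fhom u : F u \is (om u).-homog.
  case: u => j /=; first exact: dhomog_comp_linear.
  by have := dhomogMn p (Y1 j); rewrite mul1n.
pose I h := exists b : J + 'I_c -> {mpoly k[m]}, h = \sum_u b u * F u.
have idI : ideal_pred I.
  split.
  - by exists (fun=> 0); rewrite big1 // => u _; rewrite mul0r.
  - move=> _ _ [b1 ->] [b2 ->]; exists (fun u => b1 u + b2 u).
    by rewrite -big_split; apply: eq_bigr => u _; rewrite mulrDl.
  - move=> h _ [b ->]; exists (fun u => h * b u).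
    by rewrite mulr_sumr; apply: eq_bigr => u _; rewrite mulrA.
have IF u : I (F u).
  exists (fun u' => (u' == u)%:R); rewrite (bigD1 u) //= eqxx mul1r big1 ?addr0 //.
  by move=> u' /negPf ->; rewrite mul0r.
have [|x xI i|N NP] := homogeneous_nullstellensatz idI.
- move=> _ s [b ->].
  exists (fun u => if (om u <= s)%N then pihomog mdeg (s - om u) (b u) else 0).
  rewrite raddf_sum; apply: eq_bigr => u _ /=.
  by rewrite (pihomog_mul _ _ (Fhom u)); case: ifP => // _; rewrite mul0r.
- pose y := \row_i x i.
  have yI h : I h -> peval h y = 0.
    by move=> /xI <-; apply: meval_eq => a; rewrite mxE.
  have yA : y *m A = 0.
    apply: gL => [j|a lt_a]; first by rewrite -subE; apply: yI; apply: (IF (inl j)).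
    have := yI _ (IF (inr (Ordinal lt_a))); rewrite /= /peval rmorphXn /=.
    move=> /eqP; rewrite expf_eq0 => /andP[_ /eqP]; rewrite -[_.@[_]]/(peval (Y _) y) YE.
    by congr (_ = 0); congr fun_of_matrix; apply: val_inj.
  have : y = 0 by rewrite -(mulmxKV Lpu y) -/A yA mul0mx.
  by move/rowP/(_ i); rewrite !mxE.
(* Weight p on the first c variables gives the linear term of Y_j^p - X_j order p. All weights are
   at least [e], so a form [g j] has order at least e wherever it vanishes. *)
pose w (i : 'I_m) := if (i < c)%N then p else e.
have w0 i : (0 < w i)%N by rewrite /w; case: ifP => _ //; apply: ltnW.
have we i : (e <= w i)%N by rewrite /w; case: ifP.
rewrite -prod_nat_if_ltn // -[\prod_(i < m) _]/(\prod_i w i)%N.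
rewrite -(size_map (mulmx^~ Lp)).
have zP z : z \in map (mulmx^~ Lp) Z -> exists2 x, x \in Z & z = x *m Lp.
  by move=> /mapP[x]; exists x.
apply: (@weighted_bezout k m w w0 _ (J + 'I_c)%type F f om N).
- rewrite map_inj_uniq // => x y /(congr1 (mulmx^~ A)).
  by rewrite /A !mulmxK.
- by case=> j //=; apply: ltnW.
- exact: Fhom.
- case=> j /=; first by rewrite subrr msize0.
  by rewrite addrAC subrr sub0r msizeN msizeX mdeg1.
- by move=> a /NP.
- move=> z [j|j] /zP[x /ZP[xp xg] ->] /=.
    apply: worder_no_constant => //.
    by rewrite mshift0 subE /A mulmxK.
  set z' := x *m Lp.
  have charM : p \in [pchar {mpoly k[m]}].
    exact: (rmorph_pchar (@mpolyC m k : {rmorphism k -> {mpoly k[m]}}) charp).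
  pose y0 := (x *m L) 0 (wd j).
  have Ysh : mshift z' (Y j) = Y j + y0%:MP.
    have -> : y0 = peval (Y j) z' by rewrite YE /A mulmxK.
    exact: mshift_linear.
  have y0p : y0 ^+ p = z' 0 (wd j).
    rewrite -phiE /y0 /z' !mxE rmorph_sum; apply: eq_bigr => a _ /=.
    by rewrite rmorphM /= phiE xp mxE.
  rewrite rmorphB rmorphXn /= Ysh mshiftX.
  have -> : (Y j + y0%:MP) ^+ p = Y j ^+ p + (z' 0 (wd j))%:MP.
    rewrite -(pFrobenius_autE charM) rmorphD /= !pFrobenius_autE.
    by rewrite -rmorphXn /= y0p.
  have -> : Y j ^+ p + (z' 0 (wd j))%:MP - ('X_(wd j) + (z' 0 (wd j))%:MP) =
            Y j ^+ p + (-1) *: 'X_(wd j) by rewrite scaleN1r; ring.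
  apply: worderD.
    rewrite -[p in worder _ p]mul1n; apply: worderXn; apply: worder_gt0 => //.
    apply: (dhomog_nemf_coeff (Y1 j)); by rewrite /= mdeg0.
  by apply: worderZ; apply: worderX; rewrite wdegU /w /= ltn_ord.
Qed.

Section PolarMpoly.

Variables (F : fieldType) (e n : nat).

(** [polar] with indeterminate arguments: the variable [mxvec_index s i] is coordinate i of the
    vector number s, flattened into one row vector to fit the point count. *)
Fixpoint polar_mpoly (rows : seq 'I_e) (f : {mpoly F[n]}) : {mpoly F[e * n]} :=
  if rows is s :: rows' then
    \sum_i 'X_(mxvec_index s i) * polar_mpoly rows' f^`M(i)
  else (f@_0)%:MP.

Lemma polar_mpoly_homog rows f : polar_mpoly rows f \is (size rows).-homog.
Proof.
elim: rows f => [|s rows IHr] f /=.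
  by rewrite -[X in X%:MP]mulr1 mpolyCM mul_mpolyC rpredZ // mpolyC1 dhomog1.
apply: rpred_sum => i _; rewrite -add1n; apply: dhomogM => //.
by rewrite dhomogX /= mdeg1.
Qed.

Lemma peval_polar_mpoly rows f (v : 'rV_(e * n)) :
  peval (polar_mpoly rows f) v = polar [seq row s (vec_mx v) | s <- rows] f.
Proof.
elim: rows f => [|s rows IHr] f /=; first by rewrite /peval mevalC.
rewrite /peval raddf_sum; apply: eq_bigr => i _ /=.
by rewrite mevalM mevalXU -IHr !mxE.
Qed.

End PolarMpoly.

Lemma mderiv_map (F k : fieldType) (iota : {rmorphism F -> k}) (n : nat)
    (f : {mpoly F[n]}) i :
  (map_mpoly iota f)^`M(i) = map_mpoly iota f^`M(i).
Proof.
by apply/mpolyP => m; rewrite !(mcoeff_deriv, mcoeff_map_mpoly) raddfMn.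
Qed.

Lemma polar_map (F k : fieldType) (iota : {rmorphism F -> k}) (n : nat)
    (hs : seq 'rV[F]_n) (f : {mpoly F[n]}) :
  polar (map (map_mx iota) hs) (map_mpoly iota f) = iota (polar hs f).
Proof.
elim: hs f => [|h hs IHhs] f /=; first by rewrite mcoeff_map_mpoly.
rewrite rmorph_sum; apply: eq_bigr => i _.
by rewrite mderiv_map IHhs rmorphM mxE.
Qed.

Lemma dhomog_map (F k : fieldType) (iota : {rmorphism F -> k}) (n s : nat)
    (f : {mpoly F[n]}) : f \is s.-homog -> map_mpoly iota f \is s.-homog.
Proof.
move=> fs; apply/dhomogP => m; rewrite mcoeff_msupp mcoeff_map_mpoly => h.
apply: (dhomog_mf fs); rewrite mcoeff_msupp; apply: contraNneq h => ->.
by rewrite raddf0.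
Qed.

Lemma peval_scale (k : fieldType) (n s : nat) (f : {mpoly k[n]}) c (x : 'rV[k]_n) :
  f \is s.-homog -> peval f (c *: x) = c ^+ s * peval f x.
Proof.
move=> fs; rewrite /peval !mevalE mulr_sumr big_seq [RHS]big_seq.
apply: eq_bigr => m /(dhomog_mf fs) /= <-; rewrite mulrCA; congr (_ * _).
under eq_bigr do rewrite mxE exprMn.
by rewrite big_split /= mdegE expr_sum.
Qed.

Lemma fact_neq0_pchar (k : fieldType) (p s : nat) :
  p \in [pchar k] -> (s < p)%N -> (s`!)%:R != 0 :> k.
Proof.
move=> charp; have p_prime := pcharf_prime charp.
rewrite -(dvdn_pcharf charp); elim: s => [|s IHs] lt_sp.
  by rewrite fact0 Euclid_dvd1.
rewrite factS Euclid_dvdM // negb_or IHs 1?ltnW // andbT.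
by rewrite gtnNdvd.
Qed.

Section CriticalLocus.

Local Open Scope classical_set_scope.

Variables (k : closedFieldType) (n : nat).

Definition critical_locus (f : {mpoly k[n]}) : set 'rV[k]_n :=
  [set x | forall j, peval f^`M(j) x = 0].

Lemma critical_locus_closed f : zariski_closed (critical_locus f).
Proof.
exists [set g | exists j, g = f^`M(j)]; apply/seteqP; split=> x /=.
  by move=> fx g [j ->].
by move=> fx j; apply: fx; exists j.
Qed.

Lemma critical_locus_cone s f c x : f \is s.+1.-homog ->
  critical_locus f x -> critical_locus f (c *: x).
Proof.
move=> fs fx j; rewrite (peval_scale _ _ (dhomog_mderiv j fs)).
by rewrite (fx j) mulr0.
Qed.

End CriticalLocus.

(* The zeros of the polarized gradient meet the diagonal in the critical locus,
   and the diagonal has codimension [n * (e - 1)]. *)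
Lemma polar_kernel_card (p n e D : nat) (k : closedFieldType)
    (iota : {rmorphism 'F_p -> k}) (Q : {mpoly 'F_p[n]}) :
  prime p -> (0 < e < p)%N -> (D <= n)%N -> Q \is e.+1.-homog ->
  (forall N, has_chain (critical_locus (map_mpoly iota Q)) N -> (N <= D)%N) ->
  (#|[set t : e.-tuple 'rV['F_p]_n | \row_j polar t Q^`M(j) == 0%R]%SET|
     <= p ^ (n * e.-1 + D) * e ^ (n - D))%N.
Proof.
move=> p_prime /andP[e0 lt_ep] le_Dn Qhom dimQ.
have charp : p \in [pchar k] by apply: (rmorph_pchar iota); apply: pchar_Fp.
pose Qb := map_mpoly iota Q.
have Qbhom : Qb \is e.+1.-homog by apply: dhomog_map.
have [L LP] := cone_linear_section (@critical_locus_closed k n Qb)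
   (fun c x => @critical_locus_cone k n e Qb c x Qbhom) dimQ.
case: e e0 lt_ep Qhom Qbhom => // e _ lt_ep Qhom Qbhom; rewrite -pred_Sn.
pose m := (e.+1 * n)%N; pose c := (e * n + D)%N.
(* The case split on [e] supplies a row 0. [dif] vanishes exactly on the diagonal, where [L] then
   acts on the common row; together they make up [c] linear forms. *)
pose dif (v : 'rV[k]_m) : 'M[k]_(e, n) :=
  \matrix_(i, j) (vec_mx v (lift ord0 i) j - vec_mx v ord0 j).
pose psi (v : 'rV[k]_m) : 'rV[k]_c :=
  row_mx (mxvec (dif v)) (row ord0 (vec_mx v) *m L).
have psi_linear : linear psi.
  move=> a u v; rewrite /psi scale_row_mx add_row_mx; congr row_mx.
    rewrite -linearP; congr mxvec; apply/matrixP => i j.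
    by rewrite !mxE; ring.
  by rewrite !linearP /= mulmxDl -scalemxAl.
pose Psi : {linear 'rV[k]_m -> 'rV[k]_c} :=
  HB.pack psi (GRing.isLinear.Build _ _ _ _ psi psi_linear).
pose C := lin1_mx Psi.
pose g j := polar_mpoly (enum 'I_e.+1) Qb^`M(j).
have gE j v : peval (g j) v = polar [seq row s (vec_mx v) | s <- enum 'I_e.+1] Qb^`M(j).
  exact: peval_polar_mpoly.
have gC v : (forall j, peval (g j) v = 0) -> v *m C = 0 -> v = 0.
  move=> gv; rewrite mul_rV_lin1 /= => /eqP; rewrite row_mx_eq0.
  case/andP => /eqP dif0 /eqP L0.
  have rows s : row s (vec_mx v) = row ord0 (vec_mx v).
    have : dif v = 0 by rewrite -[dif v]mxvecK dif0 linear0.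
    move=> /matrixP d0; apply/rowP => j; rewrite !mxE.
    case: (unliftP ord0 s) => [i ->|-> //]; apply/eqP.
    by have := d0 i j; rewrite !mxE => /eqP; rewrite subr_eq0.
  have x0 : row ord0 (vec_mx v) = 0.
    apply: LP => // j; have := gv j; rewrite gE.
    rewrite (eq_map rows) (_ : map _ _ = nseq e.+1 (row ord0 (vec_mx v))); last first.
      have cst T (l : seq T) : [seq row ord0 (vec_mx v) | _ <- l] =
          nseq (size l) (row ord0 (vec_mx v)) by elim: l => //= _ l ->.
      by rewrite cst size_enum_ord.
    rewrite (polar_diag _ (dhomog_mderiv j Qbhom)) => /eqP.
    by rewrite mulf_eq0 (negPf (fact_neq0_pchar charp lt_ep)) => /eqP.
  rewrite -[v]vec_mxK (_ : vec_mx v = 0) ?linear0 //.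
  by apply/row_matrixP => s; rewrite rows x0 row0.
pose toV (t : e.+1.-tuple 'rV['F_p]_n) : 'rV[k]_m :=
  mxvec (map_mx iota (\matrix_(s < e.+1) tnth t s)).
have toVinj : injective toV.
  move=> t1 t2 /(can_inj mxvecK)/map_mx_inj E; apply/eq_from_tnth => s.
  by have := congr1 (row s) E; rewrite !rowK.
have toVP t j : peval (g j) (toV t) = iota (polar t Q^`M(j)).
  rewrite gE mxvecK -[in RHS](map_tnth_enum t) -polar_map mderiv_map.
  congr (polar _ _); rewrite -(map_comp (map_mx iota) (tnth t)).
  by apply: eq_map => s /=; rewrite -map_row rowK.
set V := [set t | _]%SET.
rewrite cardE -(size_map toV).
have mE : (m - c = n - D)%N by rewrite /m /c mulSn; lia.
rewrite -mE [(n * e)%N]mulnC -/c.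
(* The count wants its linear forms as leading coordinates of an invertible matrix. C factors as
   [col_ebase C] times a partial identity times an invertible matrix, so if the first c coordinates
   of v times [col_ebase C] vanish, then so does [v *m C]. *)
apply: (frobenius_fixed_points_bound charp (g := g) (L := col_ebase C)).
- by rewrite /c /m mulSn; lia.
- by rewrite (ltnW lt_ep).
- by move=> j; have := polar_mpoly_homog (enum 'I_e.+1) Qb^`M(j); rewrite size_enum_ord.
- exact: col_ebase_unit.
- move=> v gv vC; apply: gC => //.
  rewrite -(mulmx_ebase C) !mulmxA (_ : v *m _ *m pid_mx _ = 0) ?mul0mx //.
  apply/rowP => j; rewrite !mxE big1 // => i _; rewrite [pid_mx _ _ _]mxE.
  case: eqP => [ij|_]; last by rewrite mulr0.
  by rewrite vC ?mul0r // ij.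
- by rewrite map_inj_uniq // enum_uniq.
- move=> v /mapP[t]; rewrite mem_enum inE => /eqP /rowP tV ->; split.
    move=> i; case/mxvec_indexP: i => a b; rewrite mxvecE !mxE.
    rewrite -rmorphXn -[X in _ = iota X]/(_) /=.
    have -> : (tnth t a 0 b : 'F_p) = (tnth t a 0 b : nat)%:R by rewrite natr_Zp.
    by rewrite -(pFrobenius_autE (pchar_Fp p_prime)) pFrobenius_aut_nat.
  by move=> j; rewrite toVP; have := tV j; rewrite !mxE => ->; rewrite rmorph0.
Qed.

Lemma has_chain_subset (k : fieldType) (n N : nat) (X Y : set 'rV[k]_n) :
  (X `<=` Y)%classic -> has_chain X N -> has_chain Y N.
Proof.
move=> XY [Z [Zirr Zlt]]; exists Z; split=> // i /Zirr[irr ZX].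
by split=> //; apply: subset_trans XY.
Qed.

(** At a critical point of a . P the row [a] annihilates the Jacobian from the left, so its rows are
    dependent. *)
Lemma critical_locus_singular (F : fieldType) (k : closedFieldType)
    (iota : {rmorphism F -> k}) (n r : nat) (P : 'I_r -> {mpoly F[n]})
    (a : 'rV[F]_r) : a != 0 ->
  (critical_locus (map_mpoly iota (\sum_i a 0 i *: P i)) `<=`
     singular_set iota P)%classic.
Proof.
move=> a0 x xa; rewrite /singular_set /= ltn_neqAle rank_leq_row andbT.
apply/negP => /row_freeP[B JB].
have : map_mx iota a *m jacobian (fun i => map_mpoly iota (P i)) x = 0.
  apply/rowP => j; rewrite !mxE -[RHS](xa j) rmorph_sum raddf_sum /peval raddf_sum.
  apply: eq_bigr => i _ /=; rewrite !mxE /peval map_mpolyZ mderivZ mevalZ.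
  by [].
move=> /(congr1 (mulmx^~ B)); rewrite -mulmxA JB mulmx1 mul0mx => /eqP.
by rewrite map_mx_eq0 (negPf a0).
Qed.

Lemma gowers_sum_0 (R : realType) (G : finZmodType) l :
  gowers_sum l (fun _ : G => 0 : R[i]) = 0.
Proof.
have -> : (fun _ : G => 0 : R[i]) = fun x => 0 * 0 by apply: funext => x; rewrite mulr0.
by rewrite gowers_sum_scale ?rmorph0 // expr0n expn_eq0 /= mul0r.
Qed.

Lemma Re_scale (R : realType) (x : R) (z : R[i]) :
  complex.Re (x%:C%C * z) = x * complex.Re z.
Proof. by case: z => a b /=; rewrite mul0r subr0. Qed.

(** * Fourier expansion of the indicator *)

Section IndicatorFunction.

Variables (R : realType) (p n r : nat) (p_prime : prime p).
Variables (chi : 'F_p -> R[i]) (chiP : additive_character chi).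
Variables (P : 'I_r -> {mpoly 'F_p[n]}) (v : 'rV['F_p]_r).

Definition level_phase (a : 'rV['F_p]_r) (x : 'rV['F_p]_n) : 'F_p :=
  \sum_i a 0 i * (peval (P i) x - v 0 i).

(** The value 0 at a = 0 absorbs the subtracted constant p^-r, while the index set keeps all p^r
    elements, so that the convexity factor later cancels exactly. *)
Definition level_character (a : 'rV['F_p]_r) (x : 'rV['F_p]_n) : R[i] :=
  if a == 0 then 0 else chi (level_phase a x).

Lemma indicator_fourier x :
  (pmap_eval P x == v)%:R - p%:R ^- r =
  p%:R ^- r * \sum_a level_character a x.
Proof.
have p0 : (p%:R : R[i]) ^+ r != 0.
  by rewrite expf_neq0 // pnatr_eq0 -lt0n prime_gt0.
have -> : \sum_a level_character a x = \sum_a chi (level_phase a x) - 1.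
  have phase0 : level_phase 0 x = 0 by apply: big1 => i _; rewrite mxE mul0r.
  rewrite [in RHS](bigD1 0) //= phase0.
  have [_ -> _ _] := chiP; rewrite addrAC subrr add0r.
  rewrite (bigD1 0) //= {1}/level_character eqxx add0r.
  by apply: eq_bigr => a a0; rewrite /level_character (negPf a0).
have -> : \sum_a chi (level_phase a x) = (p ^ r)%:R * (pmap_eval P x == v)%:R.
  have -> : \sum_a chi (level_phase a x) =
      \sum_(a : 'rV['F_p]_r) chi (\sum_j a 0 j * (pmap_eval P x - v) 0 j).
    apply: eq_bigr => a _; congr chi; apply: eq_bigr => i _.
    by rewrite !mxE.
  rewrite (character_orthogonality chiP) subr_eq0 card_mx card_Fp // mul1n.
  by case: eqP; rewrite ?mulr1 ?mulr0.
by rewrite mulrBr mulr1 natrX mulrA mulVf // mul1r.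
Qed.

Lemma gowers_sum_level_character e a :
  (forall i, P i \is e.+1.-homog) -> a != 0 ->
  gowers_sum e.+1 (level_character a) =
  (#|{: 'rV['F_p]_n}| ^ 2 *
   #|[set t : e.-tuple 'rV['F_p]_n |
        \row_j polar t (\sum_i a 0 i *: P i)^`M(j) == 0]|)%:R.
Proof.
move=> Phom a0; set Q := \sum_i _.
(* Removing the constant a . v spoils homogeneity but changes neither the gradient nor the degree
   bound, which is all that [add_derivs_polar] requires. *)
pose Q' := Q - (\sum_i a 0 i * v 0 i)%:MP.
have Q'E x : level_phase a x = peval Q' x.
  rewrite /level_phase /Q' /Q /peval mevalB mevalC raddf_sum -sumrB.
  by apply: eq_bigr => i _ /=; rewrite mevalZ mulrBr.
have -> : level_character a = chi \o peval Q'.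
  by apply: funext => x; rewrite /level_character (negPf a0) Q'E.
apply: (gowers_sum_phase chiP (L := fun t => \row_j polar t Q^`M(j))) => t x h.
rewrite add_derivs_polar.
  apply: eq_bigr => j _; rewrite mxE /Q' mderivB mderivC subr0 //.
rewrite size_tuple; apply: leq_trans (msizeD_le _ _) _; rewrite geq_max msizeN msizeC.
rewrite (leq_trans (leq_b1 _)) // andbT; apply: dhomog_msize_leq.
by apply: rpred_sum => i _; apply: rpredZ; apply: Phom.
Qed.

End IndicatorFunction.

Theorem proposition2 (R : realType) (p n r d : nat)
  (hp : prime p) (hn : (1 <= n)%N) (hr : (1 <= r)%N)
  (hd2 : (2 <= d)%N) (hdp : (d < p)%N)
  (Fbar : closedFieldType) (iota : {rmorphism 'F_p -> Fbar})
  (Fbar_alg : integralRange iota)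
  (P : 'I_r -> {mpoly 'F_p[n]}) (P_homog : forall i, P i \is d.-homog)
  (v : 'rV['F_p]_r) (S : {set 'rV['F_p]_n})
  (hS : S = [set x | pmap_eval P x == v]%SET)
  (K : nat) (hK : is_codim (singular_set iota P) K) :
  gowers_norm d (fun x : 'rV['F_p]_n => (x \in S)%:R - p%:R ^- r : R[i])
  <= (d%:R - 1) `^ (n%:R / 2 ^+ d) * p%:R `^ ((r%:R - K%:R) / 2 ^+ d).
Proof.
have [chi chiP] := additive_character_exists R hp.
case: hK => D [_ dimD] DKn.
case: d hd2 hdp P_homog => // e; rewrite ltnS => e0 lt_ep Phom.
have p0 : (0 < p)%N := prime_gt0 hp.
have pR : (0 < p%:R :> R) by rewrite ltr0n.
pose f := level_character chi P v.
pose N := (#|{: 'rV['F_p]_n}| ^ e.+2)%N.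
have cardG : #|{: 'rV['F_p]_n}| = (p ^ n)%N by rewrite card_mx card_Fp // mul1n.
pose B := (p ^ (n * e.-1 + D) * e ^ (n - D))%N.
have sumB a : complex.Re (gowers_sum e.+1 (f a)) <= (#|{: 'rV['F_p]_n}| ^ 2 * B)%:R.
  have [->|a0] := eqVneq a 0.
    have -> : f 0 = fun=> 0 by apply: funext => x; rewrite /f /level_character eqxx.
    rewrite gowers_sum_0. by rewrite ler0n.
  rewrite (gowers_sum_level_character chiP v Phom a0).
  rewrite -(rmorph_nat (real_complex R)) /= ler_nat leq_mul2l; apply/orP; right.
  apply: (polar_kernel_card (iota := iota)) => //.
  - by rewrite e0 ltnW.
  - by rewrite -DKn leq_addr.
  - by apply: rpred_sum => i _; apply: rpredZ; apply: Phom.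
  - by move=> M /(has_chain_subset (critical_locus_singular (iota := iota) a0))/dimD.
pose X : R := (p%:R ^- r) ^+ (2 ^ e.+1) *
  (complex.Re (gowers_sum e.+1 (fun x => \sum_a f a x)) / N%:R).
have normE : gowers_norm e.+1 (fun x : 'rV['F_p]_n => (x \in S)%:R - p%:R ^- r : R[i]) =
    X `^ (2 ^+ e.+1)^-1.
  have -> : (fun x : 'rV['F_p]_n => (x \in S)%:R - p%:R ^- r : R[i]) =
     fun x => (p%:R ^- r : R)%:C%C * \sum_a f a x.
    apply: funext => x; rewrite hS inE (indicator_fourier hp chiP).
    by rewrite rmorphV ?rmorphXn ?rmorph_nat // unitfE expf_neq0 // gt_eqF.
  rewrite gowers_normE gowers_sum_scale; last exact: conjc_real.
  rewrite -rmorphXn /= -mulrA Re_scale; congr ((_ * _) `^ _).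
  rewrite mulrC -(rmorph_nat (real_complex R)) -fmorphV /= Re_scale mulrC.
  by [].
have X0 : 0 <= X.
  apply: mulr_ge0; first by rewrite exprn_ge0 // invr_ge0 exprn_ge0 // ltW.
  apply: divr_ge0; last exact: ler0n.
  rewrite gowers_sum_sqr Re_sum; apply: sumr_ge0 => t _.
  by rewrite normCK; case: (\sum_x _) => a b /=; rewrite mulrN opprK addr_ge0 // -expr2 sqr_ge0.
have cardT : #|{: 'rV['F_p]_r}| = (p ^ r)%N by rewrite card_mx card_Fp // mul1n.
have sum_f : complex.Re (gowers_sum e.+1 (fun x => \sum_a f a x)) <=
    ((p ^ r) ^ (2 ^ e.+1) * (#|{: 'rV['F_p]_n}| ^ 2 * B))%:R.
  apply: le_trans (gowers_sum_convex _ _ _) _; first by rewrite cardT expn_gt0 p0.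
  have -> : ((p ^ r) ^ (2 ^ e.+1) = p ^ r * (p ^ r) ^ (2 ^ e.+1 - 1))%N.
    by rewrite -expnS; congr (_ ^ _)%N; rewrite subn1 prednK // expn_gt0.
  rewrite cardT mulnAC natrM mulr_natr ler_wMn2r // mulnC natrM mulr_natr -cardT -sumr_const.
  by apply: ler_sum => a _; apply: sumB.
(* The proportion of e-tuples counted by [B] is (e/p)^K, written without division. *)
have BE : (B * p ^ K = e ^ K * #|{: 'rV['F_p]_n}| ^ e)%N.
  rewrite cardG -expnM /B; have -> : (n - D = K)%N by rewrite -DKn addKn.
  rewrite mulnAC -expnD mulnC -addnA DKn; congr (_ * p ^ _)%N.
  by rewrite -mulnSr prednK.
(* The p^r summands and the convexity factor together give (p^r)^(2^d), cancelling the scalar p^-r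
   raised to the power 2^d. *)
have XB : X <= e%:R ^+ K / p%:R ^+ K.
  pose u : R := p%:R ^+ r ^+ (2 ^ e.+1).
  have u0 : 0 < u by rewrite !exprn_gt0.
  have G0 : 0 < (#|{: 'rV['F_p]_n}|%:R : R) by rewrite ltr0n cardG expn_gt0 p0.
  rewrite /X exprVn -/u mulrC ler_pdivrMr // ler_pdivrMr ?ltr0n ?expn_gt0 ?cardG ?expn_gt0 ?p0 //.
  apply: le_trans sum_f _; rewrite natrM !natrX -/u [_ * u]mulrC -mulrA ler_pM2l //.
  rewrite mulrAC ler_pdivlMr ?exprn_gt0 //.
  rewrite -!natrX -!natrM ler_nat.
  by rewrite -mulnA BE mulnCA -expnD.
rewrite normE.
have -> : (e.+1%:R - 1) `^ (n%:R / 2 ^+ e.+1) * p%:R `^ ((r%:R - K%:R) / 2 ^+ e.+1)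
   = (e%:R ^+ n * p%:R `^ (r%:R - K%:R)) `^ (2 ^+ e.+1)^-1 :> R.
  rewrite -natr1 addrK !powRrM powR_mulrn ?ler0n // powRM ?powR_ge0 ?exprn_ge0 //.
have rhs0 : 0 <= e%:R ^+ n * p%:R `^ (r%:R - K%:R) :> R.
  by rewrite mulr_ge0 ?exprn_ge0 ?powR_ge0.
apply: ge0_ler_powR; rewrite ?nnegrE ?invr_ge0 ?exprn_ge0 //.
(* The stated bound is weaker than (e/p)^K in both factors: e^K <= e^n since K <= n, and p^-K <=
   p^(r-K). *)
apply: le_trans XB _; apply: ler_pM; rewrite ?exprn_ge0 ?invr_ge0 ?exprn_ge0 //.
  by rewrite ler_weXn2l ?ler1n // -DKn leq_addl.
have -> : (p%:R ^+ K)^-1 = p%:R `^ (- K%:R) :> R by rewrite powRN powR_mulrn.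
apply: ler_powR; first by rewrite ler1n.
by rewrite lerDr ler0n.
Qed.
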